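(* Let $\Phi_{KZ}$ be the Drinfel'd associator and let $\gamma=p_{35}\circ p_{52}\circ p_{24}\circ p_{41}\circ p_{13}$. The relation $$\Phi_{KZ}(X_{12},X_{23})\Phi_{KZ}(X_{34},X_{45})\Phi_{KZ}(X_{51},X_{12})\Phi_{KZ}(X_{23},X_{34})\Phi_{KZ}(X_{45},X_{51})=1\quad\text{in }U\mathfrak B_5$$ is equivalent to the family of relations $$\forall\, b_4\in B_4,\ b_4\ne1,\qquad \int_\gamma \mathrm{Reg}(b_4^*,\gamma)=0 .$$ Moreover this family is exactly the family of relations: for all $b_4\in B_4$, $b_4\neq1$, $$\sum_{W\in\mathcal A}l_{b_4,W}\Bigg(\sum_{\substack{U_1,\ldots,U_5\in\mathcal A\\ U_1\cdots U_5=W}}\ \prod_{i=1}^5(-1)^{\mathrm{dp}(\rho_i(U_i))}\zeta^{sh}(\rho_i(U_i))\Bigg)=0,$$ i.e. for every $b_4\in B_4$, $b_4\neq 1$, the left-hand side of the last relation is equal to $\int_\gamma\mathrm{Reg}(b_4^*,\gamma)$. Here $\mathcal A=\{X_{34},X_{45},X_{24},X_{12},X_{23}\}^*$.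
   Context: **Words and multiple zeta values.** $S^*$ is the set of words in $S$ (with empty word $\emptyset=1$). For a word in $X_0,X_1$, $\mathrm{dp}$ is its number of letters $X_1$. $(\zeta^{sh}(W))_{W\in\{X_0,X_1\}^*}$ are the shuffle-regularized multiple zeta values: $\zeta^{sh}(X_0)=\zeta^{sh}(X_1)=0$; $\zeta^{sh}(X_0^{k_1-1}X_1\cdots X_0^{k_p-1}X_1)=\sum_{n_1>\cdots>n_p>0}n_1^{-k_1}\cdots n_p^{-k_p}$ if $k_1\ge2$; and $\zeta^{sh}(V)\zeta^{sh}(W)=\sum_U\zeta^{sh}(U)$ over all shuffles $U$ of $V,W$ (with multiplicity); $\zeta^{sh}(\emptyset)=1$, and by convention $\zeta^{sh}(0)=0$. The Drinfel'd associator is $\Phi_{KZ}(X_0,X_1)=\sum_W(-1)^{\mathrm{dp}(W)}\zeta^{sh}(W)W\in\mathbb C\langle\langle X_0,X_1\rangle\rangle$, and $\Phi_{KZ}(A,B)$ denotes substitution. **$U\mathfrak B_5$ and $B_4$.** $U\mathfrak B_5$ is the quotient of $\mathbb C\langle\langle X_{ij}\rangle\rangle$ ($1\le i,j\le5$) by $X_{ii}=0$, $X_{ij}=X_{ji}$, $\sum_jX_{ij}=0$, and $[X_{ij},X_{kl}]=0$ if $\{i,j\}\cap\{k,l\}=\emptyset$. $B_4$ is the basis of $U\mathfrak B_5$ formed by the elements $UV$ with $U\in\{X_{24},X_{34},X_{45}\}^*$, $V\in\{X_{12},X_{23}\}^*$; it comes from $U\mathfrak B_5\simeq\mathbb C\langle\langle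 X_{24},X_{34},X_{45}\rangle\rangle\rtimes\mathbb C\langle\langle X_{12},X_{23}\rangle\rangle$. For $W\in\mathcal A$ write $W=\sum_{b_4\in B_4}l_{b_4,W}b_4$ in $U\mathfrak B_5$. **The maps $\rho_i$.** $\rho_1,\ldots,\rho_5$ are multiplicative maps from $\mathcal A$ to $\{X_0,X_1\}^*\cup\{0\}$ with $\rho_i(\emptyset)=1$ and: $\rho_1$: $X_{12}\mapsto X_0$, $X_{23}\mapsto X_1$, other letters $\mapsto0$; $\rho_2$: $X_{34}\mapsto X_0$, $X_{45}\mapsto X_1$, others $\mapsto0$; $\rho_3$: $X_{12}\mapsto X_1$, $X_{23},X_{34},X_{24}\mapsto X_0$, $X_{45}\mapsto0$; $\rho_4$: $X_{23}\mapsto X_0$, $X_{34}\mapsto X_1$, others $\mapsto0$; $\rho_5$: $X_{45}\mapsto X_0$, $X_{23},X_{34},X_{24}\mapsto X_1$, $X_{12}\mapsto0$. **Geometry.** $\mathcal M_{0,5}=\{(x,y)\in(\mathbb P^1)^2: x,y\ne0,1,\infty,\ xy\neq1\}$ (the point $(x,y)$ being the class of $(z_1,\ldots,z_5)=(0,xy,y,1,\infty)$), with dihedral coordinates $u_{ij}=u_{ji}$: $u_{25}=x$, $u_{35}=y$, $u_{14}=1-xy$, $u_{13}=\frac{1-x}{1-xy}$, $u_{24}=\frac{1-y}{1-xy}$. The forms $d\log u_{ij}$ are a basis of $H^1_{dR}(\mathcal M_{0,5})$. Put $\omega_{12}=d\log u_{25}$, $\omega_{23}=d\log(u_{13}u_{14})$,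 $\omega_{34}=d\log(u_{24}u_{14})$, $\omega_{45}=d\log u_{35}$, $\omega_{24}=d\log u_{14}$. For $W=X_{i_nj_n}\cdots X_{i_1j_1}\in\mathcal A$, $\omega_W=[\omega_{i_nj_n}|\cdots|\omega_{i_1j_1}]\in H^1_{dR}(\mathcal M_{0,5})^{\otimes n}$. The dual basis $(b_4^* )$ of $B_4$, a basis of Brown's bar construction $V(\mathcal M_{0,5})$ (the space of linear combinations of bar symbols satisfying the integrability condition), is $b_4^*=\sum_{W\in\mathcal A}l_{b_4,W}\,\omega_W$. **Boundary, paths, regularization.** In the partial compactification $\mathcal M_{0,5}^\delta$ (on which the $u_{ij}$ are regular functions), let $D_{ij}=D_{ji}$ be the divisor $u_{ij}=0$, and $P_3=D_{35}\cap D_{13}$, $P_1=D_{13}\cap D_{41}$, $P_4=D_{41}\cap D_{24}$, $P_2=D_{24}\cap D_{52}$, $P_5=D_{52}\cap D_{35}$. On $D_{ij}$ the two coordinates $u_{kl}$ whose chord crosses the chord $(i,j)$ of the pentagon are identically $1$; the remaining two restrict to functions $t,1-t$. For $j\equiv i-2\bmod5$, $p_{ji}$ is the real segment in $D_{ji}$ going from $P_i$ to $P_j$; choose the coordinate $t$ on $D_{ji}$ with $t=0$ at $P_i$, $t=1$ at $P_j$. $\mathrm{Reg}(\cdot,D_{ij})$ is the linear map sending $d\log u_{kl}$ to $0$ if $u_{kl}|_{D_{ij}}$ is identically $0$ or $1$, and to $d\log(u_{kl}|_{D_{ij}})$ otherwise, extended to tensors slotwise. The regularized iterated integral $\int_{p_{ji}}$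 on words in $\frac{dt}{t},\frac{dt}{t-1}$ is the shuffle-regularized integral over $0<t_1<\cdots<t_n<1$ of $[\nu_n|\cdots|\nu_1]\mapsto\nu_1(t_1)\wedge\cdots\wedge\nu_n(t_n)$: it equals this convergent integral if $\nu_n=\frac{dt}t$ and $\nu_1=\frac{dt}{t-1}$, vanishes on the single forms $\frac{dt}t,\frac{dt}{t-1}$, and is multiplicative for the shuffle product. Composition: $\beta\circ\alpha$ means first $\alpha$ then $\beta$, and for $\gamma=p_{35}\circ p_{52}\circ p_{24}\circ p_{41}\circ p_{13}$, $\int_\gamma\mathrm{Reg}(\omega_W,\gamma)=\sum_{U_1\cdots U_5=W}\int_{p_{35}}\mathrm{Reg}(\omega_{U_1},D_{35})\int_{p_{52}}\mathrm{Reg}(\omega_{U_2},D_{52})\int_{p_{24}}\mathrm{Reg}(\omega_{U_3},D_{24})\int_{p_{41}}\mathrm{Reg}(\omega_{U_4},D_{41})\int_{p_{13}}\mathrm{Reg}(\omega_{U_5},D_{13})$, extended linearly. *)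

(* Defs.v *)
From HB Require Import structures.
From mathcomp Require Import all_boot all_order all_algebra.
From mathcomp Require Import all_classical all_reals all_analysis.
From mathcomp Require Import complex.
From mathcomp Require Import ring.

Set Implicit Arguments.
Unset Strict Implicit.
Unset Printing Implicit Defensive.

Import Order.TTheory GRing.Theory Num.Theory.

Local Open Scope classical_set_scope.
Local Open Scope ring_scope.
Local Open Scope complex_scope.

(* A word in X_0, X_1 is a [seq bool]; the leftmost letter is the head. *)
Notation X0 := false (only parsing).
Notation X1 := true (only parsing).

Definition dp (w : seq bool) : nat := count_mem X1 w.

Fixpoint shuffle (T : Type) (u : seq T) : seq T -> seq (seq T) :=
  fix shuffle_u (v : seq T) : seq (seq T) :=
    match u, v with
    | [::], _ => [:: v]
    | _, [::] => [:: u]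
    | a :: u', b :: v' =>
        [seq a :: s | s <- shuffle u' v] ++ [seq b :: s | s <- shuffle_u v']
    end.

Definition shuffle_multiplicative (R : pzRingType) (z : seq bool -> R) :=
  forall v w : seq bool, z v * z w = \sum_(u <- shuffle v w) z u.

Definition mzv (R : realType) (k : seq nat) : R :=
  fine (\esum_(n in [set n : seq nat |
                      [/\ size n = size k, sorted gtn n & all (leq 1) n]])
          (\prod_(m <- zip n k) (m.1%:R ^- m.2 : R))%:E).

(* X_0^{k_1-1} X_1 ... X_0^{k_p-1} X_1 *)
Definition mzv_word (k : seq nat) : seq bool :=
  flatten [seq rcons (nseq i.-1 X0) X1 | i <- k].

Record is_zeta_sh (R : realType) (z : seq bool -> R) : Prop := {
  zeta_sh_nil : z [::] = 1;
  zeta_sh_X0 : z [:: X0] = 0;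
  zeta_sh_X1 : z [:: X1] = 0;
  zeta_sh_mzv : forall (k1 : nat) (k : seq nat), (2 <= k1)%N -> all (leq 1) k ->
    z (mzv_word (k1 :: k)) = mzv R (k1 :: k);
  zeta_sh_shuffle : shuffle_multiplicative z }.

(* X_0 stands for dt/t and X_1 for dt/(t-1). *)
Definition line_form (R : realType) (x : bool) (t : R) : R :=
  if x then (t - 1)^-1 else t^-1.

(* [nu_n | ... | nu_1] is sent to the integral of nu_1(t_1) ... nu_n(t_n) over
   0 < t_1 < ... < t_n < t, computed with t_n outermost. *)
Fixpoint iterated_integral (R : realType) (w : seq bool) (t : R) : R :=
  if w is x :: w' then
    \int[@lebesgue_measure R]_(s in `]0, t[)
      (line_form x s * iterated_integral w' s)
  else 1.

Record is_reg_integral (R : realType) (I : seq bool -> R) : Prop := {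
  reg_integral_nil : I [::] = 1;
  reg_integral_X0 : I [:: X0] = 0;
  reg_integral_X1 : I [:: X1] = 0;
  reg_integral_cvg : forall w : seq bool,
    I (X0 :: rcons w X1) = iterated_integral (X0 :: rcons w X1) 1;
  reg_integral_shuffle : shuffle_multiplicative I }.

(* A series is given by its coefficients on words. *)
Definition series (K A : Type) := seq A -> K.

Section Series.
Variables (K : comNzRingType) (A : eqType).
Implicit Types f g : series K A.

Definition ser_mono (w : seq A) : series K A := fun v => (v == w)%:R.
Definition ser_zero : series K A := fun=> 0.
Definition ser_one : series K A := ser_mono [::].
Definition ser_add f g : series K A := fun w => f w + g w.
Definition ser_sub f g : series K A := fun w => f w - g w.
Definition ser_mul f g : series K A :=
  fun w => \sum_(k < (size w).+1) f (take k w) * g (drop k w).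

(* phi(B_0, B_1), for B_0 and B_1 without constant term: only the words of
   length at most [size v] contribute to the coefficient of v. *)
Definition ser_subst (phi : series K bool) (B0 B1 : series K A) : series K A :=
  fun v => \sum_(n < (size v).+1) \sum_(w : n.-tuple bool)
    phi w * (\big[ser_mul/ser_one]_(x <- w) (if x then B1 else B0)) v.

Inductive ideal (G : set (series K A)) : series K A -> Prop :=
| ideal_gen f : G f -> ideal G f
| ideal_zero : ideal G ser_zero
| ideal_add f g : ideal G f -> ideal G g -> ideal G (ser_add f g)
| ideal_mull f g : ideal G g -> ideal G (ser_mul f g)
| ideal_mulr f g : ideal G f -> ideal G (ser_mul f g).

(* Closure of the two-sided ideal for the topology defined by the degree. *)
Definition closed_ideal (G : set (series K A)) (f : series K A) : Prop :=
  forall n : nat, exists2 g, ideal G g &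
    forall w : seq A, (size w <= n)%N -> f w = g w.

End Series.

(* The indices 1, ..., 5 are taken in 'Z_5, so that 5 = 0. *)
Definition idx : Type := 'Z_5.

Definition Xgen (K : comNzRingType) (i j : idx) : series K (idx * idx)%type :=
  ser_mono K [:: (i, j)].

Inductive UB5_rel (K : comNzRingType) : set (series K (idx * idx)%type) :=
| UB5_diag i : UB5_rel (Xgen K i i)
| UB5_sym i j : UB5_rel (ser_sub (Xgen K i j) (Xgen K j i))
| UB5_sum i : UB5_rel (fun w => \sum_(j : 'Z_5) Xgen K i j w)
| UB5_comm i j k l : i != k -> i != l -> j != k -> j != l ->
    UB5_rel (ser_sub (ser_mul (Xgen K i j) (Xgen K k l))
                     (ser_mul (Xgen K k l) (Xgen K i j))).

Definition eqUB5 (K : comNzRingType) (f g : series K (idx * idx)%type) : Prop :=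
  closed_ideal (@UB5_rel K) (ser_sub f g).

Inductive letter := X34 | X45 | X24 | X12 | X23.

Definition letter_code (x : letter) : 'I_5 :=
  inord (match x with X34 => 0 | X45 => 1 | X24 => 2 | X12 => 3 | X23 => 4 end).
Definition letter_decode (i : 'I_5) : letter :=
  nth X34 [:: X34; X45; X24; X12; X23] i.
Lemma letter_codeK : cancel letter_code letter_decode.
Proof. by case; rewrite /letter_decode inordK. Qed.
HB.instance Definition _ := Finite.copy letter (can_type letter_codeK).

Definition word := seq letter.

Definition letter_idx (x : letter) : idx * idx :=
  match x with
  | X34 => (3, 4) | X45 => (4, 5) | X24 => (2, 4) | X12 => (1, 2) | X23 => (2, 3)
  end.

Definition word_series (K : comNzRingType) (W : word) :
    series K (idx * idx)%type :=
  ser_mono K (map letter_idx W).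

Definition B4 : set word :=
  [set b | exists U V : word,
     [/\ all (mem [:: X24; X34; X45]) U, all (mem [:: X12; X23]) V
       & b = U ++ V]].

(* The series sum_{b in B_4} a_b b; [letter_idx] is injective, so each
   coefficient is a sum of at most one term. *)
Definition B4_series (K : comNzRingType) (a : word -> K) :
    series K (idx * idx)%type :=
  fun w => \sum_(b \in B4 `&` [set b | map letter_idx b = w]) a b.

(* [l b W] is the coefficient l_{b,W}: W = sum_b l_{b,W} b in UB_5. *)
Definition is_B4_coord (K : comNzRingType) (l : word -> word -> K) : Prop :=
  forall W : word, eqUB5 (word_series K W) (B4_series (l ^~ W)).

Definition Phi_KZ (R : realType) (zsh : seq bool -> R) : series R[i] bool :=
  fun W => (-1) ^+ dp W * (zsh W)%:C.

Definition pentagon (R : realType) (zsh : seq bool -> R) : Prop :=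
  let X (i j : idx) := Xgen R[i] i j in
  let Phi A B := ser_subst (Phi_KZ zsh) A B in
  eqUB5
    (ser_mul (Phi (X 1 2) (X 2 3))
      (ser_mul (Phi (X 3 4) (X 4 5))
        (ser_mul (Phi (X 5 1) (X 1 2))
          (ser_mul (Phi (X 2 3) (X 3 4))
                   (Phi (X 4 5) (X 5 1))))))
    (@ser_one _ _).

(* [None] stands for the word 0. *)
Definition rho1 (x : letter) : option bool :=
  match x with X12 => Some X0 | X23 => Some X1 | _ => None end.
Definition rho2 (x : letter) : option bool :=
  match x with X34 => Some X0 | X45 => Some X1 | _ => None end.
Definition rho3 (x : letter) : option bool :=
  match x with
  | X12 => Some X1 | X23 | X34 | X24 => Some X0 | X45 => None
  end.
Definition rho4 (x : letter) : option bool :=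
  match x with X23 => Some X0 | X34 => Some X1 | _ => None end.
Definition rho5 (x : letter) : option bool :=
  match x with
  | X45 => Some X0 | X23 | X34 | X24 => Some X1 | X12 => None
  end.

Definition rhos : 5.-tuple (letter -> option bool) :=
  [tuple rho1; rho2; rho3; rho4; rho5].

Fixpoint rho_word (r : letter -> option bool) (W : word) : option (seq bool) :=
  if W is x :: W' then
    match r x, rho_word r W' with
    | Some a, Some w => Some (a :: w)
    | _, _ => None
    end
  else Some [::].

(* (-1)^{dp(w)} zeta^sh(w), extended by zeta^sh(0) = 0. *)
Definition signed_zeta (R : realType) (zsh : seq bool -> R)
    (w : option (seq bool)) : R[i] :=
  if w is Some w' then (-1) ^+ dp w' * (zsh w')%:C else 0.

Definition relation_lhs (R : realType) (zsh : seq bool -> R)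
    (l : word -> word -> R[i]) (b : word) : R[i] :=
  \sum_(W \in [set: word]) l b W *
    \sum_(U \in [set U : 5.-tuple word | flatten U = W])
      \prod_(i < 5) signed_zeta zsh (rho_word (tnth rhos i) (tnth U i)).

(* A chord of the pentagon is encoded by the unique k such that it is
   {k, k+2}. *)
Definition chord : Type := 'Z_5.
Definition c13 : chord := 1.
Definition c24 : chord := 2.
Definition c35 : chord := 3.
Definition c41 : chord := 4.
Definition c52 : chord := 5.

Definition on_chord (i : idx) (c : chord) : bool := (i == c) || (i == c + 2).

Definition crosses (c d : chord) : bool :=
  [forall i : 'Z_5, ~~ (on_chord i c && on_chord i d)].

Section Geometry.
Variable R : realType.
Local Notation C := R[i].

Definition M05 : set (C * C) :=
  [set p | [/\ p.1 != 0, p.1 != 1, p.2 != 0, p.2 != 1 & p.1 * p.2 != 1]].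

Definition dihedral (p : C * C) : chord -> C := fun c =>
  let: (x, y) := p in
  if c == c52 then x else
  if c == c35 then y else
  if c == c41 then 1 - x * y else
  if c == c13 then (1 - x) / (1 - x * y) else
  (1 - y) / (1 - x * y).

(* The affine variety with coordinate ring generated by the u_c, subject to
   u_c + prod_{d crossing c} u_d = 1. *)
Definition M05d : set (chord -> C) :=
  [set u | forall c : 'Z_5, u c + \prod_(d : 'Z_5 | crosses c d) u d = 1].

Definition divisor (c : chord) : set (chord -> C) := M05d `&` [set u | u c = 0].

(* The point P_i, at which the two chords through i vanish. *)
Definition vertex (i : idx) : chord -> C :=
  fun c => if on_chord i c then 0 else 1.

(* The divisor D_{ji}, j = i - 2, parametrized by its coordinate t, with t = 0
   at P_i and t = 1 at P_j; p_{ji} is the image of [0, 1].  The chord {j, i}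
   is encoded by j. *)
Definition edge (j : chord) (t : C) : chord -> C :=
  fun c => (1 - t) * vertex (j + 2) c + t * vertex j c.

Lemma chord_ind (P : chord -> Prop) :
  P c13 -> P c24 -> P c35 -> P c41 -> P c52 -> forall c, P c.
Proof.
move=> h1 h2 h3 h4 h5 -[[|[|[|[|[|//]]]]] lt].
- by rewrite (_ : Ordinal lt = c52)//; apply/val_inj.
- by rewrite (_ : Ordinal lt = c13)//; apply/val_inj.
- by rewrite (_ : Ordinal lt = c24)//; apply/val_inj.
- by rewrite (_ : Ordinal lt = c35)//; apply/val_inj.
- by rewrite (_ : Ordinal lt = c41)//; apply/val_inj.
Qed.

Lemma crossesE (c d : chord) : crosses c d = (d == c + 1) || (d == c - 1).
Proof.
apply/forallP/idP => [h|].
  move: (h c) (h (c + 2)) => {h}.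
  by elim/chord_ind: c; elim/chord_ind: d.
by move=> h i; move: h; elim/chord_ind: c; elim/chord_ind: d; elim/chord_ind: i.
Qed.

Lemma prod_crosses (c : chord) (u : chord -> C) :
  \prod_(d : 'Z_5 | crosses c d) u d = u (c + 1) * u (c - 1).
Proof.
rewrite (eq_bigl _ _ (crossesE c)) (bigD1 (c + 1)) ?eqxx//=; congr (_ * _).
rewrite (bigD1 (c - 1)) /=; last first.
  by rewrite eqxx orbT /=; elim/chord_ind: c.
rewrite big1 ?mulr1// => d.
by case: (d == c + 1) => //=; case: (d == c - 1).
Qed.

Lemma chordD1 : (c13 + 1 = c24) * (c24 + 1 = c35) * (c35 + 1 = c41)
  * (c41 + 1 = c52) * (c52 + 1 = c13).
Proof. by do !split; apply/val_inj. Qed.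

Lemma chordB1 : (c13 - 1 = c52) * (c24 - 1 = c13) * (c35 - 1 = c24)
  * (c41 - 1 = c35) * (c52 - 1 = c41).
Proof. by do !split; apply/val_inj. Qed.

Lemma chordD2 : (c13 + 2 = c35) * (c24 + 2 = c41) * (c35 + 2 = c52)
  * (c41 + 2 = c13) * (c52 + 2 = c24).
Proof. by do !split; apply/val_inj. Qed.

Lemma chordB2 : (c13 - 2 = c41) * (c24 - 2 = c52) * (c35 - 2 = c13)
  * (c41 - 2 = c24) * (c52 - 2 = c35).
Proof. by do !split; apply/val_inj. Qed.

Lemma M05dE (u : chord -> C) :
  M05d u <-> [/\ u c13 + u c24 * u c52 = 1, u c24 + u c35 * u c13 = 1,
    u c35 + u c41 * u c24 = 1, u c41 + u c52 * u c35 = 1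
    & u c52 + u c13 * u c41 = 1].
Proof.
have e c : u c + \prod_(d : 'Z_5 | crosses c d) u d =
    u c + u (c + 1) * u (c - 1) by rewrite prod_crosses.
split=> [h|[h1 h2 h3 h4 h5] c].
  by split; [move: (h c13) | move: (h c24) | move: (h c35) | move: (h c41)
    | move: (h c52)]; rewrite e chordD1 chordB1.
by rewrite e; elim/chord_ind: c; rewrite chordD1 chordB1.
Qed.

Lemma vertexE (i : idx) :
  divisor i `&` divisor (i - 2) = [set vertex i].
Proof.
apply/seteqP; split => u /=.
  move=> [[/M05dE[h1 h2 h3 h4 h5] /= ui] [_ /= ui2]].
  apply/funext; move: ui ui2 h1 h2 h3 h4 h5.
  by elim/chord_ind: i; rewrite chordB2 => a b; rewrite a b;
    rewrite ?(mul0r, mulr0, add0r, addr0) => *; elim/chord_ind.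
have vM : M05d (vertex i).
  by apply/M05dE; elim/chord_ind: i; rewrite /vertex /=;
    rewrite ?(mul0r, mulr0, mulr1, add0r, addr0).
by move=> ->; split; split => //; elim/chord_ind: (i).
Qed.

Lemma edgeE (j : chord) : range (edge j) = divisor j.
Proof.
apply/seteqP; split => [u [t _ <-]|u].
  split; first apply/M05dE; elim/chord_ind: j;
    rewrite /edge /vertex /= ?(mul0r, mulr0, mulr1, add0r, addr0, subrK)//;
    by do ?split; ring.
move=> [/M05dE[h1 h2 h3 h4 h5] /= uj].
exists (u (j + 2)) => //; apply/funext; move: uj h1 h2 h3 h4 h5.
elim/chord_ind: j; rewrite chordD2 => a; rewrite a;
  rewrite ?(mul0r, mulr0, add0r, addr0) => h1 h2 h3 h4 h5; elim/chord_ind;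
  rewrite /edge /vertex /= ?(mul0r, mulr0, mulr1, add0r, addr0, subrK)//.
- by rewrite -h4 h5 mul1r addrK.
- by rewrite -h5 h1 mul1r addrK.
- by rewrite -h1 h2 mul1r addrK.
- by rewrite -h2 h3 mul1r addrK.
- by rewrite -h3 h4 mul1r addrK.
Qed.

Lemma dihedralE : dihedral @` M05 = M05d `&` [set u | forall c, u c != 0].
Proof.
apply/seteqP; split => [u [[x y] /= [x0 x1 y0 y1 xy]] <-|u [/M05dE h /= u0]].
  have xy0 : 1 - x * y != 0 by rewrite subr_eq0 eq_sym.
  split; first by apply/M05dE; rewrite /dihedral /=; split; field.
  by elim/chord_ind; rewrite /dihedral//= mulf_neq0 ?invr_eq0 // subr_eq0 eq_sym.
move: h => [h1 h2 h3 h4 h5].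
have e4 : 1 - u c52 * u c35 = u c41 by rewrite -h4 addrK.
have ne (a b : C) : a + b = 1 -> b != 0 -> a != 1.
  by move=> <- b0; rewrite -subr_eq0 opprD addNKr oppr_eq0.
exists (u c52, u c35) => /=.
  split=> /=; rewrite ?u0//.
  - by apply: (ne _ (u c13 * u c41)); rewrite ?mulf_neq0.
  - by apply: (ne _ (u c41 * u c24)); rewrite ?mulf_neq0.
  - by rewrite eq_sym -subr_eq0 e4.
apply/funext; elim/chord_ind; rewrite /dihedral//= e4.
- by rewrite -h5 [u c52 + _]addrC addrK mulfK.
- by rewrite -h3 [u c35 + _]addrC addrK mulrC mulKf.
Qed.

End Geometry.

Section Integral.
Variable R : realType.
Local Notation C := R[i].

(* H^1_dR(M_{0,5}), in coordinates on its basis (d log u_c)_c. *)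
Definition H1dR : Type := chord -> C.

Definition dlogu (c : chord) : H1dR := fun d => (d == c)%:R.

Definition omega (x : letter) : H1dR :=
  match x with
  | X12 => dlogu c52
  | X23 => fun d => dlogu c13 d + dlogu c41 d
  | X34 => fun d => dlogu c24 d + dlogu c41 d
  | X45 => dlogu c35
  | X24 => dlogu c41
  end.

Lemma omega_basis (eta : H1dR) : exists! a : letter -> C, forall c,
  eta c = a X12 * omega X12 c + a X23 * omega X23 c + a X34 * omega X34 c
        + a X45 * omega X45 c + a X24 * omega X24 c.
Proof.
pose s := (mulr0, mulr1, add0r, addr0).
exists (fun x => match x with
  | X12 => eta c52 | X23 => eta c13 | X34 => eta c24 | X45 => eta c35
  | X24 => eta c41 - eta c13 - eta c24 end); split => [|a ha].
  by elim/chord_ind; rewrite /omega /dlogu /= ?s//; ring.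
have h c := ha c.
move: (h c13) (h c24) (h c35) (h c41) (h c52).
rewrite /omega /dlogu /= ?s => -> -> -> -> ->.
by apply/funext; case => //; ring.
Qed.

(* a dt/t + b dt/(t-1) is given by its coefficients a on X0 and b on X1. *)
Definition lform : Type := bool -> C.

(* d log f for f = t and f = 1 - t, the only nonconstant restrictions of the
   u_c to a divisor. *)
Definition dlog_line (f : C -> C) : lform := fun x =>
  if `[< forall t, f t = t >] then (x == X0)%:R
  else if `[< forall t, f t = 1 - t >] then (x == X1)%:R
  else 0.

Definition Reg_dlogu (j c : chord) : lform :=
  if `[< (forall u : chord -> C, divisor j u -> u c = 0) \/
         (forall u : chord -> C, divisor j u -> u c = 1) >]
  then fun=> 0
  else dlog_line (fun t => edge j t c).

Definition Reg (j : chord) (eta : H1dR) : lform :=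
  fun x => \sum_(c : 'Z_5) eta c * Reg_dlogu j c x.

(* The regularized integral of [nu_n | ... | nu_1], by multilinearity from its
   values I on words in dt/t, dt/(t-1). *)
Definition line_integral (I : seq bool -> R) (nus : seq lform) : C :=
  \sum_(w : (size nus).-tuple bool)
    (\prod_(k < size nus) nth (fun=> 0) nus k (tnth w k)) * (I w)%:C.

(* The divisors met by gamma = p_35 o p_52 o p_24 o p_41 o p_13, in the order
   of the factors of a composition (last path first). *)
Definition gamma : 5.-tuple chord := [tuple c35; c52; c24; c41; c13].

Definition gamma_integral_word (I : seq bool -> R) (W : word) : C :=
  \sum_(U \in [set U : 5.-tuple word | flatten U = W])
    \prod_(k < 5) line_integral I
      [seq Reg (tnth gamma k) (omega x) | x <- tnth U k].

(* An element of the tensor algebra of H^1_dR(M_{0,5}) is given by its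
   coefficients on the basis (omega_W)_W (see [omega_basis]); [dual_B4 l b] is b^* = sum_W l_{b,W} omega_W. *)
Definition tensor : Type := word -> C.

Definition dual_B4 (l : word -> word -> C) (b : word) : tensor :=
  fun W => l b W.

Definition gamma_integral (I : seq bool -> R) (a : tensor) : C :=
  \sum_(W \in [set: word]) a W * gamma_integral_word I W.

End Integral.

(* Main.v *)
Require Import Defs.
From HB Require Import structures.
From mathcomp Require Import all_boot all_order all_algebra.
From mathcomp Require Import all_classical all_reals all_analysis.
From mathcomp Require Import measurable_realfun complex.
From mathcomp Require Import ring.

Set Implicit Arguments.
Unset Strict Implicit.
Unset Printing Implicit Defensive.

Import Order.TTheory GRing.Theory Num.Theory.
Import numFieldNormedType.Exports.

Local Open Scope classical_set_scope.
Local Open Scope ring_scope.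

(** Why the theorem holds.

The second claim is an identity between the coefficients of the two families.
Restricted to the five boundary divisors met by [gamma], the forms [omega x]
become dt/t, dt/(t-1) or 0 exactly as prescribed by the maps rho_i
([Reg_omega]), so both sides sum, over the factorizations of W in five pieces,
products of five factors, and it is enough to compare
(-1)^dp(w) zeta^sh(w) with the regularized integral of w
([reg_integral_zeta]).  For a convergent word the sign comes from
dt/(t-1) = -dt/(1-t), and the integral of the positive forms is expanded in a
power series whose coefficients are nonnegative, so that sums and integrals
commute by monotone convergence, up to and including t = 1
([iterated_integral_polylog], [mzv_polylog]).  The other words are settled
because a shuffle-multiplicative map is determined by its values on X0, X1 and
the convergent words ([insertion_free_eq0]).

For the first claim, X_51 = X_23 + X_34 + X_24 in UB_5 ([eqUB5_X51]), so the
left-hand side of the pentagon relation is congruent to the series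
sum_W c_W W in the five letters, c_W being the sum over the factorizations of W
above ([pentagon_emb]).  Rewriting each W in the basis B_4 gives
sum_b (sum_W l_{b,W} c_W) b.  If all these coefficients with b <> 1 vanish, the
pentagon relation follows, degree by degree.  The converse needs the linear
independence of B_4 in UB_5.  It is obtained from a module on which UB_5 acts:
series in words U in X_24, X_34, X_45 tensor words V in X_12, X_23, where the
first three letters multiply U on the left, while X_12 and X_23 multiply V on
the left and act on U by the derivations that define the semidirect product
([letter_op_comm], [act_UB5_rel]).  Applied to 1 (x) 1, the basis word UV
gives U (x) V ([word_act_B4]), so the coordinates l_{b,W} can be read off the
action of W ([B4_coordE]); in particular they vanish unless W and b have the
same length, which makes the sums over W finite. *)

(** * Uniqueness of the shuffle regularization *)

Section Regularization.
Variable V : zmodType.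
Implicit Types (d : seq bool -> V) (u v w : seq bool).

(** The only consequence of shuffle multiplicativity that is used: if the
letter [x] has value 0, so does its shuffle with any word.  Unlike
multiplicativity, this condition is linear in [d], so it passes to the
difference of two regularizations. *)
Definition insertion_free d x := forall u, \sum_(s <- shuffle [:: x] u) d s = 0.

Lemma shuffle1_cons x y u :
  shuffle [:: x] (y :: u) =
  (x :: y :: u) :: [seq y :: s | s <- shuffle [:: x] u].
Proof. by []. Qed.

Lemma shuffle1_rcons x y u :
  perm_eq (shuffle [:: x] (rcons u y))
    (rcons (rcons u y) x :: [seq rcons s y | s <- shuffle [:: x] u]).
Proof.
elim: u => [|z u IH].
  by apply/permP => p /=; rewrite addnCA.
rewrite rcons_cons !shuffle1_cons /=.
apply/permP => p /=; rewrite (permP (perm_map (cons z) IH)) /=.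
rewrite addnCA; congr (_ + (_ + _))%N.
by rewrite -!map_comp.
Qed.

Lemma shuffle1_rev x u :
  perm_eq (shuffle [:: x] (rev u)) [seq rev s | s <- shuffle [:: x] u].
Proof.
elim: u => [//|y u IH].
rewrite rev_cons shuffle1_cons /=; apply: (perm_trans (shuffle1_rcons _ _ _)).
rewrite !rev_cons perm_cons -map_comp.
apply: (perm_trans (perm_map (rcons^~ y) IH)).
have e : rcons^~ y \o rev =1 rev \o cons y by move=> s /=; rewrite rev_cons.
by rewrite -map_comp (eq_map e); exact: perm_refl.
Qed.

Lemma insertion_free_rev d x :
  insertion_free d x -> insertion_free (d \o rev) x.
Proof.
move=> h u; rewrite -(big_map rev xpredT d).
by rewrite -(perm_big _ (shuffle1_rev x u)).
Qed.

(** Inserting [x] in or next to an initial run of [n] copies of [x] always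
gives the same word; the insertion just after the run is counted in the second
term. *)
Lemma sum_shuffle1_nseq d x n v :
  \sum_(s <- shuffle [:: x] (nseq n x ++ v)) d s =
  d (nseq n.+1 x ++ v) *+ n + \sum_(s <- shuffle [:: x] v) d (nseq n x ++ s).
Proof.
elim: n d => [|n IH] d; first by rewrite mulr0n add0r.
rewrite [nseq _ _ ++ v]/= shuffle1_cons big_cons big_map /=.
by rewrite (IH (d \o cons x)) /= addrA -mulrS.
Qed.

Hypothesis Vtf : forall (a : V) n, a *+ n.+1 = 0 -> a = 0.

Lemma cat_nseq_cons n (x : bool) u : nseq n x ++ x :: u = nseq n.+1 x ++ u.
Proof. by elim: n => //= n ->. Qed.

(** Induction on the length of the initial run of [x]: among the insertions of
[x] in a word with a run of length n, those that do not lengthen the run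
vanish by induction, and the others are n+1 copies of the word with a run of
length n+1.  The class [C] makes room for a condition on the end of the words.
*)
Lemma insertion_free_strip d x (C : pred (seq bool)) :
  insertion_free d x ->
  (forall v, C v -> all C (shuffle [:: x] v)) ->
  (forall v, C v -> d (~~ x :: v) = 0) ->
  forall n v, C v -> d (nseq n x ++ ~~ x :: v) = 0.
Proof.
move=> dx Cx d0; elim=> [|n IH] v Cv; first exact: d0.
have := dx (nseq n x ++ ~~ x :: v); rewrite sum_shuffle1_nseq.
rewrite shuffle1_cons big_cons big_map.
rewrite big1_seq ?addr0; last by move=> s /= /(allP (Cx v Cv)); exact: IH.
by rewrite cat_nseq_cons -mulrSr => /Vtf.
Qed.

Lemma insertion_free_nseq d x n : insertion_free d x -> d (nseq n.+1 x) = 0.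
Proof.
move=> dx; have := dx (nseq n x ++ [::]).
rewrite sum_shuffle1_nseq [X in _ + X]big_cons big_nil addr0.
by rewrite cat_nseq_cons cats0 -mulrSr => /Vtf.
Qed.

Lemma nseq_split x w :
  (exists n, w = nseq n x) \/ exists n v, w = nseq n x ++ ~~ x :: v.
Proof.
elim: w => [|y w IH]; first by left; exists 0%N.
have [->|yx] := eqVneq y x.
  case: IH => [[n ->]|[n [v ->]]]; first by left; exists n.+1.
  by right; exists n.+1, v.
right; exists 0%N, w; congr (_ :: _).
by case: x y yx {IH} => -[].
Qed.

(** Trailing letters X0 are removed first, by stripping leading ones from the
reversed words; this settles the words that begin with X0.  Then leading
letters X1 are removed. *)
Lemma insertion_free_eq0 d :
  insertion_free d false -> insertion_free d true ->
  d [::] = 0 -> (forall w, d (false :: rcons w true) = 0) ->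
  forall w, d w = 0.
Proof.
move=> d0 d1 dnil dcvg.
have dfalse v : d (false :: v) = 0.
  rewrite -[_ :: _]revK rev_cons.
  have [[n e]|[n [u e]]] := nseq_split false (rev v).
    rewrite e -cats1 cat_nseq_cons cats0.
    rewrite -[d _]/((d \o rev) _) insertion_free_nseq//.
    exact: insertion_free_rev.
  rewrite e rcons_cat /= -[d _]/((d \o rev) _).
  (* [u] is the reverse of a word from which the last X1 has been removed: it
     must still end in X0 for the convergent case to apply. *)
  pose C (u : seq bool) := (u != [::]) && (last true u == false).
  apply: (@insertion_free_strip _ _ C (insertion_free_rev d0)) => {e v}.
  - case/lastP => // {}u y; rewrite /C last_rcons => /andP[_ /eqP ->].
    rewrite (perm_all _ (shuffle1_rcons _ _ _)) /=.
    rewrite !last_rcons /= -!size_eq0 !size_rcons /=.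
    apply/allP => _ /mapP[s _ ->].
    by rewrite last_rcons -size_eq0 size_rcons.
  - case/lastP => // {}u y; rewrite /C last_rcons => /andP[_ /eqP ->].
    by rewrite /= rev_cons rev_rcons; exact: dcvg.
  - by rewrite /C /= last_rcons -size_eq0 size_rcons.
move=> w; have [[[|n] ->]|[n [v ->]]] := nseq_split true w.
- exact: dnil.
- exact: insertion_free_nseq.
- by apply: (@insertion_free_strip _ _ predT) => // u _; apply/allP.
Qed.

End Regularization.

Lemma dp_shuffle u v : all (fun s => dp s == dp u + dp v)%N (shuffle u v).
Proof.
rewrite /dp; elim: u v => [|x u IHu] v.
  by case: v => [|y v] //=; rewrite eqxx.
elim: v => [|y v IHv]; first by rewrite /= addn0 eqxx.
rewrite [shuffle _ _]/= all_cat !all_map; apply/andP; split; apply/allP => s.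
  by move=> /(allP (IHu _)) /eqP /= ->; rewrite addnA.
by move=> /(allP IHv) /eqP /= ->; rewrite addnCA.
Qed.

Lemma signed_regularization_unique (R : numDomainType) (z I : seq bool -> R) :
  z [::] = 1 -> z [:: false] = 0 -> z [:: true] = 0 ->
  shuffle_multiplicative z ->
  I [::] = 1 -> I [:: false] = 0 -> I [:: true] = 0 ->
  shuffle_multiplicative I ->
  (forall w, I (false :: rcons w true) =
     (-1) ^+ dp (false :: rcons w true) * z (false :: rcons w true)) ->
  forall w, I w = (-1) ^+ dp w * z w.
Proof.
move=> z0 zX0 zX1 zsh I0 IX0 IX1 Ish IE w.
apply/eqP; rewrite -subr_eq0; apply/eqP.
pose d w := I w - (-1) ^+ dp w * z w; rewrite -/(d w).
have dfree x : insertion_free d x.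
  move=> u; rewrite /d sumrB -Ish; have -> : I [:: x] = 0 by case: x.
  rewrite mul0r big_seq (eq_bigr (fun s => (-1) ^+ (dp [:: x] + dp u) * z s)).
    rewrite -big_seq -mulr_sumr -zsh; have -> : z [:: x] = 0 by case: x.
    by rewrite mul0r mulr0 subr0.
  by move=> s /(allP (dp_shuffle _ _)) /eqP ->.
apply: insertion_free_eq0 => //.
  by move=> a n /eqP; rewrite mulrn_eq0 => /eqP.
  by rewrite /d I0 z0 mulr1 subrr.
by move=> v; rewrite /d IE subrr.
Qed.

(** * Iterated integrals as power series *)

Section PowerSeries.
Variable R : realType.
Implicit Types (w : seq bool) (s t : R).
Local Notation mu := (@lebesgue_measure R).

(** The Taylor coefficients at 0 of the multiple polylogarithm of [w], defined
by iterated integration with dt/(1-t) in place of dt/(t-1).  Integration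
divides the n-th coefficient by n, and multiplication by 1/(1-t) replaces
coefficients by partial sums.  Since 1/0 = 0, the constant term of a nonempty
word is 0. *)
Fixpoint polylog_coef w : nat -> R :=
  if w is x :: w' then fun n =>
    (if x then \sum_(m < n) polylog_coef w' m else polylog_coef w' n) / n%:R
  else fun n => (n == 0)%:R.

Lemma polylog_coef0 x w : polylog_coef (x :: w) 0 = 0.
Proof. by rewrite /= invr0 mulr0. Qed.

Lemma polylog_coef_ge0 w n : 0 <= polylog_coef w n.
Proof.
elim: w n => [|x w IH] n /=; first exact: ler0n.
by rewrite mulr_ge0 ?invr_ge0//; case: x => //; exact: sumr_ge0.
Qed.

(** This crude bound gives convergence on [0, 1[. *)
Lemma polylog_coef_le1 w n : polylog_coef w n <= 1.
Proof.
elim: w n => [|x w IH] [|n] /=; rewrite ?invr0 ?mulr0 ?ler01 ?ler10//.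
rewrite ler_pdivrMr ?ltr0Sn// mul1r; case: x.
  apply: (@le_trans _ _ (\sum_(m < n.+1) 1)); first exact: ler_sum.
  by rewrite sumr_const card_ord.
by apply: (le_trans (IH _)); rewrite ler1n.
Qed.

Definition polylog w s : \bar R :=
  (\sum_(0 <= n <oo) (polylog_coef w n * s ^+ n)%:E)%E.

Lemma powser_ge0 (a : nat -> R) s : (forall n, 0 <= a n) -> 0 <= s ->
  forall n, (0 <= (a n * s ^+ n)%:E)%E.
Proof. by move=> a0 s0 n; rewrite lee_fin mulr_ge0 ?exprn_ge0. Qed.

Lemma polylog_ge0 w s : 0 <= s -> (0 <= polylog w s)%E.
Proof.
move=> s0; apply: nneseries_ge0 => n _ _.
by apply: powser_ge0 => // m; exact: polylog_coef_ge0.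
Qed.

Lemma powser_recl (a : nat -> R) s : (forall n, 0 <= a n) -> 0 <= s ->
  (\sum_(0 <= n <oo) (a n * s ^+ n)%:E =
   (a 0)%:E + s%:E * \sum_(0 <= n <oo) (a n.+1 * s ^+ n)%:E)%E.
Proof.
move=> a0 s0; rewrite nneseries_recl//; last by move=> k _; exact: powser_ge0.
rewrite expr0 mulr1; congr (_ + _)%E.
rewrite -nneseriesZl; last first.
  by move=> i _; apply: (@powser_ge0 (fun n => a n.+1)).
rewrite -[LHS]nneseries_addn; last by move=> i; exact: powser_ge0.
by apply: eq_eseriesr => i _; rewrite -EFinM addn1 exprS mulrCA.
Qed.

Lemma geometric_eseries s : 0 <= s < 1 ->
  (\sum_(0 <= n <oo) (s ^+ n)%:E = ((1 - s)^-1)%:E)%E.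
Proof.
move=> /andP[s0 s1].
have h := @cvg_geometric_series R 1 s; rewrite ger0_norm// mul1r in h.
apply: cvg_lim => //; apply: cvg_EFin.
  by apply: nearW => n; rewrite sumEFin.
rewrite [X in X @ _ --> _](_ : _ = sequences.series (geometric 1 s)).
  exact: h.
apply/funext => n; rewrite /= sumEFin.
by apply: eq_bigr => i _; rewrite /= mul1r.
Qed.

Lemma polylog_fin w s : 0 <= s < 1 -> polylog w s \is a fin_num.
Proof.
move=> /[dup] s01 /andP[s0 s1]; rewrite ge0_fin_numE ?polylog_ge0//.
apply: (@le_lt_trans _ _ (\sum_(0 <= n <oo) (s ^+ n)%:E)%E); last first.
  by rewrite geometric_eseries// ltry.
apply: lee_nneseries => [n _ _|n _].
  by apply: powser_ge0 => // m; exact: polylog_coef_ge0.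
by rewrite lee_fin ler_piMl ?exprn_ge0 ?polylog_coef_le1.
Qed.

Lemma tail_geometric_eseries m s : 0 <= s < 1 ->
  (\sum_(0 <= n <oo) ((m <= n)%:R * s ^+ n)%:E = (s ^+ m * (1 - s)^-1)%:E)%E.
Proof.
move=> /[dup] s01 /andP[s0 s1]; elim: m => [|m IH].
  rewrite expr0 mul1r -geometric_eseries//.
  by apply: eq_eseriesr => n _; rewrite mul1r.
by rewrite powser_recl// add0e IH -EFinM exprS mulrA.
Qed.

(** The Cauchy product with the geometric series: all terms are nonnegative,
so the double sum can be computed in either order. *)
Lemma cauchy_geometric_eseries (a : nat -> R) s :
  (forall n, 0 <= a n) -> 0 <= s < 1 ->
  (\sum_(0 <= n <oo) ((\sum_(m < n.+1) a m) * s ^+ n)%:E =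
   ((1 - s)^-1)%:E * \sum_(0 <= n <oo) (a n * s ^+ n)%:E)%E.
Proof.
move=> a0 /[dup] s01 /andP[s0 s1].
rewrite -nneseriesZl; last by move=> i _; exact: powser_ge0.
transitivity (\sum_(0 <= n <oo) \sum_(0 <= m <oo)
    (a m * ((m <= n)%:R * s ^+ n))%:E)%E.
  apply: eq_eseriesr => n _.
  rewrite (nneseries_split 0 n.+1); last first.
    by move=> k _; rewrite lee_fin !mulr_ge0 ?exprn_ge0.
  rewrite add0n [X in (_ + X)%E]eseries0 ?adde0; last first.
    by move=> i ni _; rewrite leqNgt ni mul0r mulr0.
  rewrite mulr_suml big_mkord -sumEFin; apply: eq_bigr => m _.
  by rewrite -ltnS ltn_ord mul1r.
rewrite nneseries_interchange; last first.
  by move=> i j; rewrite lee_fin !mulr_ge0 ?exprn_ge0.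
apply: eq_eseriesr => m _.
under eq_eseriesr do rewrite EFinM.
rewrite nneseriesZl; last first.
  by move=> i _; rewrite lee_fin mulr_ge0 ?exprn_ge0.
by rewrite tail_geometric_eseries// -!EFinM mulrA mulrC.
Qed.

Definition pos_form (x : bool) s : R := if x then (1 - s)^-1 else s^-1.

Lemma pos_form_ge0 x s : 0 <= s < 1 -> 0 <= pos_form x s.
Proof.
move=> /andP[s0 s1]; case: x; rewrite /= invr_ge0//.
by rewrite subr_ge0 ltW.
Qed.

(** A word ending in X1 has a polylogarithm without constant term, unless it
is empty; division by [s] is thus a shift of the coefficients. *)
Lemma pos_form_polylog x w s : last true (x :: w) -> 0 < s < 1 ->
  ((pos_form x s)%:E * polylog w s =
   \sum_(0 <= n <oo) (polylog_coef (x :: w) n.+1 *+ n.+1 * s ^+ n)%:E)%E.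
Proof.
move=> lw /andP[s0 s1].
transitivity (\sum_(0 <= n <oo) ((if x then \sum_(m < n.+1) polylog_coef w m
    else polylog_coef w n.+1) * s ^+ n)%:E)%E; last first.
  apply: eq_eseriesr => n _; congr (_ * _)%:E.
  by rewrite -[RHS]mulr_natr divfK// pnatr_eq0.
case: x lw => /=.
  move=> _; rewrite cauchy_geometric_eseries ?ltW//.
  by move=> n; exact: polylog_coef_ge0.
case: w => // y w _; rewrite /polylog powser_recl ?ltW//; last first.
  by move=> n; exact: polylog_coef_ge0.
by rewrite polylog_coef0 add0e muleA -EFinM mulVf ?mul1e// gt_eqF.
Qed.

Lemma integral_exprn n t : 0 <= t ->
  (\int[mu]_(s in `]0%R, t[) (s ^+ n)%:E = (t ^+ n.+1 / n.+1%:R)%:E)%E.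
Proof.
rewrite le_eqVlt => /predU1P[<-|t0].
  by rewrite set_itv_ge ?bnd_simp ?ltxx// integral_set0 expr0n /= mul0r.
rewrite integral_itv_obnd_cbnd; last first.
  by apply/measurable_EFinP; exact: measurable_funX.
rewrite integral_itv_bndo_bndc; last first.
  by apply/measurable_EFinP; exact: measurable_funX.
have dF (x : R) : is_derive x 1 (fun s : R => s ^+ n.+1 / n.+1%:R) (x ^+ n).
  have n0 : n.+1%:R != 0 :> R by rewrite pnatr_eq0.
  rewrite (_ : (fun s => _) = n.+1%:R^-1 \*: (@id R) ^+ n.+1); last first.
    by apply/funext => s; rewrite /= exprfctE mulrC.
  by apply: is_derive_eq; rewrite /GRing.scale /= mulr1 mulKf.
have cF (x : R) : {for x, continuous (fun s : R => s ^+ n.+1 / n.+1%:R)}.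
  by apply: differentiable_continuous; apply/derivable1_diffP; have [] := dF x.
rewrite (@continuous_FTC2 _ _ (fun s : R => s ^+ n.+1 / n.+1%:R))//.
- by rewrite expr0n /= mul0r sube0.
- by apply: continuous_subspaceT => x; exact: exprn_continuous.
- split; first by move=> x _; have [] := dF x.
    by apply: cvg_at_right_filter; exact: cF.
  by apply: cvg_at_left_filter; exact: cF.
- by move=> x _; rewrite derive1E; have [_ ->] := dF x.
Qed.

(** Term by term integration of a series of nonnegative functions.  At [t = 1]
both sides may be infinite. *)
Lemma integral_pos_form x w t : last true (x :: w) -> 0 <= t <= 1 ->
  (\int[mu]_(s in `]0%R, t[) ((pos_form x s)%:E * polylog w s) =
   polylog (x :: w) t)%E.
Proof.
move=> lw /andP[t0 t1].
have c0 n : 0 <= polylog_coef (x :: w) n.+1 *+ n.+1.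
  by rewrite mulrn_wge0 ?polylog_coef_ge0.
transitivity (\int[mu]_(s in `]0%R, t[) \sum_(0 <= n <oo)
    (polylog_coef (x :: w) n.+1 *+ n.+1 * s ^+ n)%:E)%E.
  apply: eq_integral => s; rewrite inE/= in_itv/= => /andP[s0 st].
  by rewrite pos_form_polylog// s0 (lt_le_trans st).
rewrite integral_nneseries//; last 2 first.
  by move=> n; apply/measurable_EFinP/measurable_funM => //;
    exact: measurable_funX.
  move=> n s; rewrite /= in_itv/= => /andP[s0 _].
  by rewrite lee_fin; apply: mulr_ge0 (c0 _) _; rewrite exprn_ge0// ltW.
rewrite {1}/polylog powser_recl ?polylog_coef0 ?add0e//; last first.
  exact: polylog_coef_ge0.
rewrite -nneseriesZl; last first.
  by move=> i _; rewrite lee_fin mulr_ge0 ?exprn_ge0 ?polylog_coef_ge0.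
apply: eq_eseriesr => n _; under eq_integral do rewrite EFinM.
rewrite ge0_integralZl_EFin//; last 2 first.
  move=> s; rewrite /= in_itv/= => /andP[s0 _].
  by rewrite lee_fin exprn_ge0 ?ltW.
  by apply/measurable_EFinP; exact: measurable_funX.
rewrite integral_exprn// -!EFinM -[polylog_coef _ _ *+ _]mulr_natr exprS.
congr (_%:E); have n0 : n.+1%:R != 0 :> R by rewrite pnatr_eq0.
by field; rewrite -[X in X + _]/(1%:R) -natrD add1n.
Qed.

Lemma line_form_pos x s : line_form x s = (-1) ^+ x * pos_form x s.
Proof.
case: x => /=; rewrite ?expr0 ?mul1r// expr1 mulN1r -invrN.
by rewrite opprB.
Qed.

(** Linearity of the integral cannot be used here: the integral of [g] may be
infinite. *)
Lemma integral_sign (b : bool) D (g : R -> \bar R) :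
  (forall s, D s -> 0 <= g s)%E ->
  (\int[mu]_(s in D) (((-1) ^+ b)%:E * g s) =
   ((-1) ^+ b)%:E * \int[mu]_(s in D) g s)%E.
Proof.
move=> g0; case: b => /=; rewrite ?expr1 ?expr0; last first.
  by rewrite mul1e; apply: eq_integral => s _; rewrite mul1e.
rewrite EFinN mulN1e -integral_ge0N//.
by apply: eq_integral => s _; rewrite mulN1e.
Qed.

(** At [t = 1] this holds even if the series diverges, because [fine] is
applied to the same extended real on both sides. *)
Lemma iterated_integral_polylog w t : last true w -> 0 <= t <= 1 ->
  iterated_integral w t = (-1) ^+ dp w * fine (polylog w t).
Proof.
elim: w t => [|x w IH] t lw t01.
  rewrite /= mul1r /polylog nneseries_recl//; last first.
    by move=> k _; apply: powser_ge0 => //; case/andP: t01.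
  by rewrite eseries0 ?adde0 /= ?mul1r// => -[|i]//= _ _; rewrite mul0r.
have /andP[t0 t1] := t01.
have lw' : last true w by case: x w lw {IH} => -[].
rewrite [iterated_integral _ _]/= /Rintegral.
transitivity (fine (\int[mu]_(s in `]0%R, t[)
   (((-1) ^+ odd (dp (x :: w)))%:E * ((pos_form x s)%:E * polylog w s)))%E).
  congr fine; apply: eq_integral => s; rewrite inE/= in_itv/= => /andP[s0 st].
  have s1 : s < 1 by exact: lt_le_trans t1.
  rewrite IH// ?ltW// signr_odd -[X in (_ * (_ * X))%E]fineK; last first.
    by rewrite polylog_fin// ltW.
  rewrite -!EFinM; congr (_%:E); rewrite line_form_pos /dp /= eqb_id exprD.
  by rewrite mulrACA mulrA.
rewrite integral_sign; last first.
  move=> s; rewrite /= in_itv/= => /andP[s0 st].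
  apply: mule_ge0; last by rewrite polylog_ge0// ltW.
  by rewrite lee_fin pos_form_ge0// ltW//= (lt_le_trans st).
rewrite integral_pos_form// signr_odd.
have := signr_odd R (dp (x :: w)); case: odd => <-; rewrite ?expr1 ?expr0.
  by rewrite EFinN mulN1e fineN mulN1r.
by rewrite mul1e mul1r.
Qed.

End PowerSeries.

(** * Convergent words and multiple zeta values *)

Section MultipleZeta.
Variable R : realType.

Definition mzv_term (n k : seq nat) : R :=
  \prod_(m <- zip n k) (m.1%:R ^- m.2).

Lemma mzv_term_ge0 n k : 0 <= mzv_term n k.
Proof. by apply: prodr_ge0 => m _; rewrite invr_ge0 exprn_ge0. Qed.

(** The summation indices n_1 > ... > n_p >= 1 with n_1 < N: the condition
[path gtn N n] bounds the first index and orders the others. *)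
Definition mzv_tails (k : seq nat) (N : nat) : set (seq nat) :=
  [set n | [/\ size n = size k, path gtn N n & all (leq 1) n]].

Lemma mzv_word_cons i k :
  mzv_word (i :: k) = nseq i.-1 false ++ true :: mzv_word k.
Proof. by rewrite /mzv_word /= -cats1 -catA. Qed.

(** A block X0^(i-1) X1 sums the coefficients once and divides i times by n.
*)
Lemma polylog_coef_mzv_word i k n : (0 < i)%N ->
  polylog_coef R (mzv_word (i :: k)) n =
  n%:R ^- i * \sum_(m < n) polylog_coef R (mzv_word k) m.
Proof.
case: i => // i _; rewrite mzv_word_cons succnK.
elim: i => [|i IH] /=; first by rewrite expr1 mulrC.
by rewrite IH mulrAC -invfM -exprSr.
Qed.

(** The sum is organized by the value [m] of the largest index.  The constant
[c] accumulates the factors already split off in the induction of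
[esum_mzv_tails]. *)
Lemma esum_mzv_heads (c : R) i k (I : set nat) : 0 <= c ->
  (forall m, I m -> (0 < m)%N) ->
  (\esum_(n in [set n | [/\ size n = size (i :: k), sorted gtn n,
                           all (leq 1) n & I (head 0%N n)]])
     (c * mzv_term n (i :: k))%:E =
   \esum_(m in I) \esum_(n in mzv_tails k m)
     (c * m%:R ^- i * mzv_term n k)%:E)%E.
Proof.
move=> c0 Ipos; rewrite esum_esum; last first.
  move=> m n _ _; rewrite lee_fin !mulr_ge0 ?invr_ge0 ?exprn_ge0//.
  exact: mzv_term_ge0.
rewrite (@reindex_esum _ _ _ (I `*`` mzv_tails k) _ (fun p => p.1 :: p.2)).
  by apply: eq_esum => -[m n] _; rewrite /mzv_term /= big_cons mulrA.
split.
- move=> [m n] [/= Im [sn pn an]]; split => //=; first by rewrite sn.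
  by rewrite Ipos.
- by move=> [m n] [m' n'] _ _ [-> ->].
- move=> [|m n] [] //= [sn] pn /andP[m0 an] Im.
  by exists (m, n).
Qed.

(** For [k] empty the only coefficient is that of degree 0, which explains the
condition [0 < N]. *)
Lemma esum_mzv_tails (c : R) k N : 0 <= c -> all (leq 1) k -> (0 < N)%N ->
  (\esum_(n in mzv_tails k N) (c * mzv_term n k)%:E =
   (c * \sum_(m < N) polylog_coef R (mzv_word k) m)%:E)%E.
Proof.
elim: k c N => [|i k IH] c N c0.
  case: N => // N _ _.
  rewrite (_ : mzv_tails _ _ = [set [::]]); last first.
    by apply/seteqP; split => [n [/size0nil //]|_ ->].
  rewrite esum_set1 ?lee_fin ?mulr_ge0 ?mzv_term_ge0// /mzv_term big_nil.
  by rewrite big_ord_recl big1 //= addr0.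
move=> /andP[i0 ka] N0.
have IN m : [set m | (0 < m < N)%N] m -> (0 < m)%N by move=> /= /andP[].
rewrite (_ : mzv_tails _ _ = [set n | [/\ size n = size (i :: k), sorted gtn n,
    all (leq 1) n & [set m | (0 < m < N)%N] (head 0%N n)]]); last first.
  apply/seteqP; split => -[|m n] [] //= sn.
    by move=> /andP[mN pn] /andP[m0 an]; rewrite m0 mN.
  by move=> pn /andP[m0 an] /andP[_ mN]; split => //; apply/andP.
rewrite esum_mzv_heads//.
transitivity (\esum_(m in [set m | (0 < m < N)%N])
    (c * polylog_coef R (mzv_word (i :: k)) m)%:E)%E.
  apply: eq_esum => m /IN m0; rewrite IH// ?mulr_ge0 ?invr_ge0 ?exprn_ge0//.
  by rewrite polylog_coef_mzv_word// mulrA.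
rewrite esum_fset; last 2 first.
- by apply: (sub_finite_set _ (finite_II N)) => m /= /andP[].
- by move=> m _; rewrite lee_fin mulr_ge0 ?polylog_coef_ge0.
rewrite (@fsbig_widen _ _ _ _ _ `I_N); last 2 first.
- by move=> m /= /andP[].
- move=> [|m] /= [mN h]; last by exfalso; apply: h.
  rewrite mzv_word_cons; case: (i.-1) => [|?] /=; by rewrite invr0 !mulr0.
by rewrite -fsbig_ord sumEFin -mulr_sumr.
Qed.

Lemma mzv_polylog i k : (0 < i)%N -> all (leq 1) k ->
  mzv R (i :: k) = fine (polylog (mzv_word (i :: k)) (1 : R)).
Proof.
move=> i0 ka; rewrite /mzv; congr fine.
have Ipos m : [set m | (0 < m)%N] m -> (0 < m)%N by [].
rewrite (_ : [set n | _] = [set n | [/\ size n = size (i :: k), sorted gtn n,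
    all (leq 1) n & [set m | (0 < m)%N] (head 0%N n)]]); last first.
  apply/seteqP; split => -[|m n] [] //= sn pn /andP[m0 an] //;
    by split => //; apply/andP.
transitivity (\esum_(n in [set n | [/\ size n = size (i :: k), sorted gtn n,
    all (leq 1) n & [set m | (0 < m)%N] (head 0%N n)]])
    (1 * mzv_term n (i :: k))%:E)%E.
  by apply: eq_esum => n _; rewrite mul1r.
rewrite esum_mzv_heads//.
transitivity (\esum_(m in [set m | (0 < m)%N])
    (polylog_coef R (mzv_word (i :: k)) m)%:E)%E.
  apply: eq_esum => m m0.
  rewrite esum_mzv_tails// ?mulr_ge0 ?invr_ge0 ?exprn_ge0//.
  by rewrite polylog_coef_mzv_word// mul1r.
rewrite -nneseries_esum; last by move=> m _; rewrite lee_fin polylog_coef_ge0.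
rewrite eseries_mkcond; apply: eq_eseriesr => -[|m] _ /=.
  rewrite mzv_word_cons; case: (i.-1) => [|?] /=; by rewrite invr0 mulr0 mul0r.
by rewrite expr1n mulr1.
Qed.

Lemma mzv_word_surj w : last true w ->
  exists2 k, all (leq 1) k & w = mzv_word k.
Proof.
elim: w => [|x w IH] lw; first by exists [::].
have lw' : last true w by case: x w lw {IH} => -[].
have [k ka e] := IH lw'.
case: x lw => lw; first by exists (1%N :: k); rewrite ?mzv_word_cons ?e.
case: k ka e => [|i k] ka e; first by rewrite e in lw.
exists (i.+1 :: k); first by case/andP: ka.
case/andP: ka => i0 _; rewrite e !mzv_word_cons.
by case: i i0 {e}.
Qed.

Lemma zeta_sh_iterated_integral (z : seq bool -> R) w : is_zeta_sh z ->
  iterated_integral (false :: rcons w true) 1 =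
  (-1) ^+ dp (false :: rcons w true) * z (false :: rcons w true).
Proof.
move=> [_ _ _ zmzv _].
rewrite iterated_integral_polylog ?lexx ?ler01 /= ?last_rcons//.
have [|k ka e] := @mzv_word_surj (rcons w true); first by rewrite last_rcons.
case: k ka e => [|i k] ka e.
  by move/(congr1 size): e; rewrite size_rcons.
move: ka => /= /andP[i0 ka].
have e' : false :: rcons w true = mzv_word (i.+1 :: k).
  by rewrite e !mzv_word_cons; case: i i0 {e}.
by rewrite e' zmzv// mzv_polylog.
Qed.

End MultipleZeta.

(** The sign (-1)^dp is compatible with shuffles, since these preserve the
number of letters X1. *)
Lemma reg_integral_zeta (R : realType) (z I : seq bool -> R) w :
  is_zeta_sh z -> is_reg_integral I -> I w = (-1) ^+ dp w * z w.
Proof.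
move=> hz [I0 IX0 IX1 Icvg Ish]; have [z0 zX0 zX1 _ zsh] := hz.
apply: signed_regularization_unique => // v.
by rewrite Icvg (zeta_sh_iterated_integral _ hz).
Qed.

(** * Restriction of the forms to the boundary divisors *)

Section BoundaryRestriction.
Variable R : realType.
Local Notation C := R[i].

Lemma edge_on (j c : chord) (t : C) :
  edge j t c = (1 - t) * (~~ on_chord (j + 2) c)%:R + t * (~~ on_chord j c)%:R.
Proof. by rewrite /edge /vertex; do 2 case: on_chord. Qed.

(** The coordinate u_c is affine along the divisor, hence determined by its
values 0 or 1 at the two end points: it is constant if they agree, and
otherwise it is t or 1 - t. *)
Lemma Reg_dlogu_on (j c : chord) x :
  Reg_dlogu R j c x =
  ((on_chord (j + 2) c != on_chord j c) && (x == on_chord j c))%:R.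
Proof.
have divE a : (forall u : chord -> C, divisor j u -> u c = a) <->
    forall t, edge j t c = a.
  rewrite -edgeE; split=> [h t|h _ [t _ <-]]; last exact: h.
  by apply: h; exists t.
have n10 : (1 : C) <> 0 by apply/eqP; exact: oner_neq0.
rewrite /Reg_dlogu /dlog_line; case: asboolP => [|h].
  move=> [] /divE h; move: (h 0) (h 1); rewrite !edge_on;
    do 2 case: on_chord;
    rewrite /= ?(mulr0, mulr1, mul0r, add0r, addr0, subr0, subrr)//;
    by move=> // *; exfalso; auto.
case e1 : (on_chord (j + 2) c) h; case e2 : (on_chord j c) => h /=.
- exfalso; apply: h; left; apply/divE => t.
  by rewrite edge_on e1 e2 !mulr0 addr0.
- case: asboolP => [_ //|[]] t.
  by rewrite edge_on e1 e2 mulr0 mulr1 add0r.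
- case: asboolP => [/(_ 0)|_].
    by rewrite edge_on e1 e2 subr0 mulr1 mulr0 addr0.
  case: asboolP => [_ //|[]] t.
  by rewrite edge_on e1 e2 mulr1 mulr0 addr0.
- exfalso; apply: h; right; apply/divE => t.
  by rewrite edge_on e1 e2 !mulr1 subrK.
Qed.

Lemma Reg_omega (k : 'I_5) (x : letter) (y : bool) :
  Reg (tnth gamma k) (omega R x) y = (tnth rhos k x == Some y)%:R.
Proof.
pose s := (mulr0, mul0r, mulr1, mul1r, add0r, addr0).
rewrite /Reg (eq_bigr _ (fun c _ => congr1 _ (Reg_dlogu_on _ c y))).
rewrite !big_ord_recl big_ord0.
case: k => -[|[|[|[|[|//]]]]] lt; rewrite !(tnth_nth c13) !(tnth_nth rho1) /=;
  case: x; case: y; by rewrite /omega /dlogu /= ?s.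
Qed.

End BoundaryRestriction.

(** * Closed ideals of noncommutative series *)

Section SeriesTheory.
Variables (K : comNzRingType) (A : eqType).
Local Notation ser := (Defs.series K A).
Implicit Types (f g : ser) (v w : seq A).

Lemma ser_mul_cons f g a w :
  ser_mul f g (a :: w) =
  f [::] * g (a :: w) + ser_mul (fun v => f (a :: v)) g w.
Proof. by rewrite /ser_mul big_ord_recl take0 drop0. Qed.

Lemma ser_mul_constl (c : K) f w :
  ser_mul (fun v => c * (v == [::])%:R) f w = c * f w.
Proof.
case: w => [|a w]; first by rewrite /ser_mul big_ord1 /= mulr1.
rewrite ser_mul_cons mulr1 /ser_mul big1 ?addr0// => i _.
by rewrite mulr0 mul0r.
Qed.

Section ClosedIdeal.
Variable G : set ser.
Local Notation cid := (closed_ideal G).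

Lemma closed_ideal_gen f : G f -> cid f.
Proof. by move=> Gf n; exists f => //; exact: ideal_gen. Qed.

Lemma closed_ideal0 : cid (fun=> 0).
Proof. by move=> n; exists (@ser_zero K A) => //; exact: ideal_zero. Qed.

Lemma closed_idealD f g : cid f -> cid g -> cid (fun w => f w + g w).
Proof.
move=> If Ig n; have [f' If' ef] := If n; have [g' Ig' eg] := Ig n.
exists (ser_add f' g'); first exact: ideal_add.
by move=> w wn; rewrite /ser_add ef// eg.
Qed.

Lemma closed_ideal_mull f g : cid g -> cid (ser_mul f g).
Proof.
move=> Ig n; have [g' Ig' eg] := Ig n.
exists (ser_mul f g'); first exact: ideal_mull.
move=> w wn; apply: eq_bigr => k _; rewrite eg//.
by rewrite size_drop (leq_trans (leq_subr _ _)).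
Qed.

Lemma closed_ideal_mulr f g : cid f -> cid (ser_mul f g).
Proof.
move=> If n; have [f' If' ef] := If n.
exists (ser_mul f' g); first exact: ideal_mulr.
move=> w wn; apply: eq_bigr => k _; rewrite ef//.
by rewrite size_take_min (leq_trans (geq_minr _ _)).
Qed.

Lemma closed_idealZ c f : cid f -> cid (fun w => c * f w).
Proof.
move=> /(closed_ideal_mull (fun v => c * (v == [::])%:R)).
by congr cid; apply/funext => w; rewrite ser_mul_constl.
Qed.

Lemma closed_ideal_sum (I : Type) (r : seq I) (P : pred I) (F : I -> ser) :
  (forall i, P i -> cid (F i)) -> cid (fun w => \sum_(i <- r | P i) F i w).
Proof.
move=> IF; elim: r => [|i r IH].
  by under eq_fun do rewrite big_nil; exact: closed_ideal0.
have [Pi|/negPf Pi] := boolP (P i);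
  under eq_fun do rewrite big_cons Pi; last exact: IH.
by apply: closed_idealD => //; exact: IF.
Qed.

Lemma closed_ideal_lim f :
  (forall n, exists2 g, cid g & forall w, (size w <= n)%N -> f w = g w) ->
  cid f.
Proof.
move=> h n; have [g /(_ n)[g' Ig' eg'] eg] := h n.
by exists g' => // w wn; rewrite eg// eg'.
Qed.

Lemma ser_mul_congr f f' g g' : cid (ser_sub f f') -> cid (ser_sub g g') ->
  cid (ser_sub (ser_mul f g) (ser_mul f' g')).
Proof.
move=> If Ig.
have := closed_idealD (closed_ideal_mulr g If) (closed_ideal_mull f' Ig).
congr cid; apply/funext => w; rewrite /ser_sub /ser_mul.
transitivity (\sum_(k < (size w).+1) (f (take k w) * g (drop k w) -
    f' (take k w) * g' (drop k w))); last by rewrite sumrB.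
rewrite -big_split.
by apply: eq_bigr => k _ /=; rewrite mulrBl mulrBr addrA subrK.
Qed.

Lemma closed_ideal_subr f : cid (ser_sub f f).
Proof.
by rewrite /ser_sub; under eq_fun do rewrite subrr; exact: closed_ideal0.
Qed.

End ClosedIdeal.

(** Each factor contributes at least one letter. *)
Lemma ser_prod_eq0 (I : Type) (F : I -> ser) (s : seq I) v :
  (forall i, F i [::] = 0) -> (size v < size s)%N ->
  (\big[@ser_mul K A/@ser_one K A]_(i <- s) F i) v = 0.
Proof.
move=> F0; elim: s v => // i s IH v /= vs.
rewrite big_cons /ser_mul big1// => -[[|k] kv] _ /=.
  by rewrite take0 F0 mul0r.
rewrite IH ?mulr0// size_drop; case: (v) kv vs => //= a u _.
by rewrite ltnS => us; rewrite subSS (leq_ltn_trans (leq_subr _ _)).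
Qed.

(** Up to degree N, a substitution is a finite sum of products, to which
[ser_mul_congr] applies. *)
Lemma ser_subst_congr (G : set ser) phi (B B' : bool -> ser) :
  (forall x, B x [::] = 0) -> (forall x, B' x [::] = 0) ->
  (forall x, closed_ideal G (ser_sub (B x) (B' x))) ->
  closed_ideal G (ser_sub (ser_subst phi (B false) (B true))
                          (ser_subst phi (B' false) (B' true))).
Proof.
move=> B0 B'0 BB'; apply: closed_ideal_lim => N.
pose P (C : bool -> ser) (w : seq bool) :=
  \big[@ser_mul K A/@ser_one K A]_(x <- w) C x.
have PE (C : bool -> ser) v : (forall x, C x [::] = 0) -> (size v <= N)%N ->
    ser_subst phi (C false) (C true) v =
    \sum_(n < N.+1) \sum_(w : n.-tuple bool) phi w * P C w v.
  move=> C0 vN; rewrite /ser_subst.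
  pose F n := \sum_(w : n.-tuple bool) phi w * P C w v.
  transitivity (\sum_(n < (size v).+1) F n).
    apply: eq_bigr => n _; apply: eq_bigr => w _; congr (_ * _ v).
    by apply: eq_bigr => -[].
  rewrite (@big_ord_widen _ _ _ _ N.+1 F) //.
  rewrite [RHS](bigID (fun n : 'I__ => n < (size v).+1)%N) /=.
  rewrite [X in _ + X]big1 ?addr0// => n; rewrite -leqNgt => vn.
  by rewrite /F big1// => w _; rewrite /P ser_prod_eq0 ?mulr0// size_tuple.
exists (fun v => \sum_(n < N.+1) \sum_(w : n.-tuple bool)
    phi w * (P B w v - P B' w v)); last first.
  move=> v vN; rewrite /ser_sub !PE// -sumrB; apply: eq_bigr => n _.
  by rewrite -sumrB; apply: eq_bigr => w _; rewrite mulrBr.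
apply: closed_ideal_sum => n _; apply: closed_ideal_sum => w _.
apply: closed_idealZ; elim: (val w) => [|x u IH].
  by rewrite /P !big_nil; exact: closed_ideal_subr.
by rewrite /P !big_cons; exact: ser_mul_congr (BB' x) IH.
Qed.

End SeriesTheory.

(** * Series in the five letters *)

Section Embedding.
Variable K : comNzRingType.
Local Notation lser := (Defs.series K letter).
Local Notation iser := (Defs.series K (idx * idx)%type).

Lemma letter_idx_inj : injective letter_idx.
Proof. by case; case. Qed.

Definition idx_letter (p : idx * idx) : letter :=
  odflt X34 [pick a | letter_idx a == p].

Lemma letter_idxK : cancel letter_idx idx_letter.
Proof.
move=> a; rewrite /idx_letter; case: pickP => [b /eqP /letter_idx_inj //|].
by move/(_ a); rewrite eqxx.
Qed.

(** The continuous algebra morphism that sends each letter to its X_ij. *)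
Definition emb (f : lser) : iser := fun v =>
  if map letter_idx (map idx_letter v) == v then f (map idx_letter v) else 0.

Variant emb_spec (v : seq (idx * idx)) : Prop :=
| EmbIn W of v = map letter_idx W
| EmbOut of (forall W, v <> map letter_idx W).

Lemma embP v : emb_spec v.
Proof.
have [<-|/eqP h] := eqVneq (map letter_idx (map idx_letter v)) v.
  exact: EmbIn erefl.
by apply: EmbOut => W e; apply: h; rewrite e (mapK letter_idxK).
Qed.

Lemma emb_map f W : emb f (map letter_idx W) = f W.
Proof. by rewrite /emb (mapK letter_idxK) eqxx. Qed.

Lemma emb_out f v : (forall W, v <> map letter_idx W) -> emb f v = 0.
Proof. by rewrite /emb; case: eqP => // e /(_ (map idx_letter v)) []. Qed.

Lemma emb_mul f g : emb (ser_mul f g) = ser_mul (emb f) (emb g).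
Proof.
apply/funext => v; case: (embP v) => [W ->|h].
  rewrite emb_map /ser_mul size_map; apply: eq_bigr => k _.
  by rewrite -map_take -map_drop !emb_map.
rewrite emb_out// /ser_mul big1// => k _.
case: (embP (take k v)) => [W1 e1|h1]; last by rewrite (emb_out _ h1) mul0r.
case: (embP (drop k v)) => [W2 e2|h2]; last by rewrite (emb_out _ h2) mulr0.
by case: (h (W1 ++ W2)); rewrite map_cat -e1 -e2 cat_take_drop.
Qed.

Lemma emb_mono W : emb (ser_mono K W) = ser_mono K (map letter_idx W).
Proof.
apply/funext => v; case: (embP v) => [W' ->|h].
  by rewrite emb_map /ser_mono (inj_eq (inj_map letter_idx_inj)).
by rewrite emb_out// /ser_mono; case: eqP => // /h.
Qed.

Lemma emb_subst phi (B0 B1 : lser) :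
  emb (ser_subst phi B0 B1) = ser_subst phi (emb B0) (emb B1).
Proof.
apply/funext => v.
have embB (w : seq bool) : \big[@ser_mul K _/@ser_one K _]_(x <- w)
    (if x then emb B1 else emb B0) =
    emb (\big[@ser_mul K _/@ser_one K _]_(x <- w) (if x then B1 else B0)).
  rewrite (big_morph emb emb_mul (emb_mono [::])).
  by apply: eq_bigr => -[].
case: (embP v) => [W ->|h].
  rewrite emb_map /ser_subst size_map; apply: eq_bigr => n _.
  by apply: eq_bigr => w _; rewrite embB emb_map.
rewrite emb_out// /ser_subst big1// => n _; rewrite big1// => w _.
by rewrite embB emb_out// mulr0.
Qed.

End Embedding.

Section LetterMorphism.
Variables (K : comNzRingType) (r : letter -> option bool).
Local Notation lser := (Defs.series K letter).

(** The sum of the letters sent to [x], as a series.  Substituting these sums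
for X0 and X1 is dual to the multiplicative extension of [r] to words. *)
Definition letters_over (x : bool) : lser := fun W =>
  if W is [:: a] then (r a == Some x)%:R else 0.

Lemma ser_prod_letters_over (w : seq bool) W :
  (\big[@ser_mul K _/@ser_one K _]_(x <- w) letters_over x) W =
  (rho_word r W == Some w)%:R.
Proof.
elim: w W => [|x w IH] W.
  rewrite big_nil /ser_one /ser_mono; case: W => // a W /=.
  by case: (r a) => // b; case: rho_word.
rewrite big_cons; case: W => [|a W]; first by rewrite /ser_mul big_ord1 mul0r.
rewrite ser_mul_cons mul0r add0r.
transitivity (ser_mul (fun v => (r a == Some x)%:R * (v == [::])%:R)
    (\big[@ser_mul K _/@ser_one K _]_(x <- w) letters_over x) W).
  apply: eq_bigr => k _; congr (_ * _); case: (take k W) => [|b v] /=.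
    by rewrite mulr1.
  by rewrite mulr0.
rewrite ser_mul_constl IH /=; case: (r a) => [b|] /=; last by rewrite mul0r.
case: (rho_word r W) => [u|]; last by rewrite mulr0.
by rewrite -natrM mulnb /eq_op /= -/eq_op.
Qed.

Lemma size_rho_word W w : rho_word r W = Some w -> size w = size W.
Proof.
elim: W w => [|a W IH] w /=; first by case=> <-.
case: (r a) => // b; case: rho_word IH => // u /(_ _ erefl) IH [<-] /=.
by rewrite IH.
Qed.

(** A word W occurs in at most one product of such sums, namely the one
indexed by its image under [r]. *)
Lemma ser_subst_letters_over phi W :
  ser_subst phi (letters_over false) (letters_over true) W =
  if rho_word r W is Some w then phi w else 0.
Proof.
have E n : \sum_(w : n.-tuple bool) phi w *
    (\big[@ser_mul K _/@ser_one K _]_(x <- w)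
       (if x then letters_over true else letters_over false)) W =
    \sum_(w : n.-tuple bool) phi w * (rho_word r W == Some (val w))%:R.
  apply: eq_bigr => w _; rewrite -ser_prod_letters_over; congr (_ * _ W).
  by apply: eq_bigr => -[].
transitivity (\sum_(n < (size W).+1) \sum_(w : n.-tuple bool)
    phi w * (rho_word r W == Some (val w))%:R).
  by apply: eq_bigr => n _; exact: E.
case: (rho_word r W) (@size_rho_word W) => [w|] hsz; last first.
  by rewrite big1// => n _; rewrite big1// => w _; rewrite mulr0.
rewrite (bigD1 ord_max)//= [X in _ + X]big1 ?addr0; last first.
  move=> n nm; rewrite big1// => u _.
  case: eqP => [[e]|]; last by rewrite mulr0.
  case/eqP: nm; apply/val_inj => /=.
  by have := hsz _ erefl; rewrite e size_tuple.
have ws : size w == size W by rewrite (hsz _ erefl).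
rewrite (bigD1 (Tuple ws))//= eqxx mulr1 big1 ?addr0// => u uw.
case: eqP => [[e]|]; last by rewrite mulr0.
by case/eqP: uw; apply/val_inj; rewrite /= e.
Qed.

End LetterMorphism.

(** * Modules over the algebra of series *)

Section SeriesAction.
Variables (K : comNzRingType) (T : finType) (M : lmodType K).
Variable op : T -> {linear M -> M}.
Local Notation ser := (Defs.series K T).
Implicit Types (f g : ser) (w : seq T) (m : M).

Definition word_act w m : M := foldr (fun a => op a) m w.

(** The action of the homogeneous component of degree [n] of a series.
Working degree by degree keeps all sums finite. *)
Fixpoint act (n : nat) f m : M :=
  if n is n'.+1 then \sum_a op a (act n' (fun w => f (a :: w)) m)
  else f [::] *: m.

Lemma eq_act n f g m : (forall w, size w = n -> f w = g w) ->
  act n f m = act n g m.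
Proof.
elim: n f g => [|n IH] f g fg /=; first by rewrite fg.
by apply: eq_bigr => a _; congr (op a _); apply: IH => w wn; rewrite fg//= wn.
Qed.

Lemma act_linearl n c f g m :
  act n (fun w => c * f w + g w) m = c *: act n f m + act n g m.
Proof.
elim: n f g => [|n IH] f g /=; first by rewrite scalerDl scalerA.
rewrite scaler_sumr -big_split /=; apply: eq_bigr => a _.
by rewrite (IH (fun w => f (a :: w)) (fun w => g (a :: w))) linearP.
Qed.

Lemma act_0l n m : act n (fun=> 0) m = 0.
Proof.
have := act_linearl n (-1) (fun=> 0) (fun=> 0) m.
by under eq_act do rewrite mulr0 addr0; rewrite scaleN1r addNr.
Qed.

Lemma act_subl n f g m : act n (ser_sub f g) m = act n f m - act n g m.
Proof.
rewrite addrC -scaleN1r -act_linearl; apply: eq_act => w _.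
by rewrite mulN1r addrC.
Qed.

Lemma act_addl n f g m : act n (ser_add f g) m = act n f m + act n g m.
Proof.
rewrite -[act n f m]scale1r -act_linearl; apply: eq_act => w _.
by rewrite mul1r.
Qed.

Lemma act_suml n (I : Type) (r : seq I) (P : pred I) (c : I -> K)
    (F : I -> ser) m :
  act n (fun w => \sum_(i <- r | P i) c i * F i w) m =
  \sum_(i <- r | P i) c i *: act n (F i) m.
Proof.
elim: r => [|i r IH]; first by rewrite big_nil -[RHS](act_0l n m);
  apply: eq_act => w _; rewrite big_nil.
rewrite big_cons; case: ifP => Pi.
  by rewrite -IH -act_linearl; apply: eq_act => w _; rewrite big_cons Pi.
by rewrite -IH; apply: eq_act => w _; rewrite big_cons Pi.
Qed.

Lemma act_0r n f : act n f 0 = 0.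
Proof.
elim: n f => [|n IH] f /=; first by rewrite scaler0.
by rewrite big1// => a _; rewrite IH linear0.
Qed.

Lemma act_mul n f g m :
  act n (ser_mul f g) m = \sum_(k < n.+1) act k f (act (n - k) g m).
Proof.
elim: n f => [|n IH] f.
  by rewrite big_ord1 /= /ser_mul big_ord1 /= scalerA.
rewrite big_ord_recl subn0 [act 0 f _]/=.
have -> : f [::] *: act n.+1 g m =
    \sum_a op a (f [::] *: act n (fun w => g (a :: w)) m).
  by rewrite /= scaler_sumr; apply: eq_bigr => a _; rewrite linearZ.
rewrite [LHS]/= exchange_big /= -big_split /=; apply: eq_bigr => a _.
rewrite -linear_sum -IH -linearD -act_linearl; congr (op a _).
by apply: eq_act => w _; rewrite ser_mul_cons.
Qed.

Lemma act_mono n w m :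
  act n (ser_mono K w) m = (n == size w)%:R *: word_act w m.
Proof.
elim: w n => [|b w IH] [|n]; rewrite /= ?scale1r ?scale0r//.
- rewrite big1// => a _.
  by rewrite (_ : (fun _ => _) = fun=> 0) ?act_0l ?linear0.
- rewrite (bigD1 b)//= [X in _ + X]big1 ?addr0; last first.
    move=> a ab; rewrite (_ : (fun _ => _) = fun=> 0) ?act_0l ?linear0//.
    by apply/funext => v; rewrite /ser_mono eqseq_cons (negPf ab).
  rewrite eqSS -linearZ -IH; congr (op b _); apply: eq_act => v _.
  by rewrite /ser_mono eqseq_cons eqxx.
Qed.

Lemma actE n f m : act n f m = \sum_(w : n.-tuple T) f w *: word_act w m.
Proof.
rewrite (_ : act n f m =
    act n (fun v => \sum_(w : n.-tuple T) f w * ser_mono K w v) m).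
  rewrite act_suml; apply: eq_bigr => w _.
  by rewrite act_mono size_tuple eqxx scale1r.
apply: eq_act => v /eqP vn; rewrite (bigD1 (Tuple vn))//= big1 ?addr0.
  by rewrite /ser_mono eqxx mulr1.
move=> w wv; rewrite /ser_mono; case: eqP; rewrite ?mulr0// => e.
by case/eqP: wv; apply/val_inj.
Qed.

(** The annihilator of M is a two-sided ideal by [act_mul], and it is closed
because each [act n] depends only on the component of degree n. *)
Lemma act_closed_ideal (G : set ser) f n m :
  (forall g k u, G g -> act k g u = 0) -> closed_ideal G f -> act n f m = 0.
Proof.
move=> G0 /(_ n)[g Ig fg].
rewrite (eq_act (g := g)); last by move=> w wn; rewrite fg ?wn.
elim: Ig n m {f fg} => {g} [g Gg|//|f g _ If _ Ig|f g _ Ig|f g _ If] n m.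
- exact: G0.
- exact: act_0l.
- by rewrite act_addl If Ig addr0.
- by rewrite act_mul big1// => k _; rewrite Ig act_0r.
- by rewrite act_mul big1.
Qed.

End SeriesAction.

(** * The semidirect product module *)

Section SemidirectModule.
Variable K : comNzRingType.
(** A function m stands for the series sum m(U, V) U (x) V.  Words in all five
letters are allowed in both factors: the relations hold there as well. *)
Definition UVmod : Type := (word * word)%type -> K^o.
HB.instance Definition _ := GRing.Lmodule.on UVmod.
Implicit Types (m : UVmod) (f : word -> K).

Definition lmulU (a : letter) m : UVmod := fun p =>
  if p.1 is c :: U then (c == a)%:R * m (U, p.2) else 0.

(** The coefficient of the word [c d] in the image of the letter [a] under the
derivation of [x].  The relations of UB_5 impose [X12, X24] = [X34 + X45, X24]
and [X23, X24] = [X24, X34] = - [X23, X34], and that the other brackets of X12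
and X23 with X24, X34, X45 vanish. *)
Definition bracket_coef (x a c d : letter) : K :=
  match x, a, c, d with
  | X12, X24, X34, X24 | X12, X24, X45, X24 => 1
  | X12, X24, X24, X34 | X12, X24, X24, X45 => -1
  | X23, X24, X24, X34 | X23, X34, X34, X24 => 1
  | X23, X24, X34, X24 | X23, X34, X24, X34 => -1
  | _, _, _, _ => 0
  end.

(** The derivation extending [bracket_coef], on coefficient functions.  By the
Leibniz rule, the word [c d ...] arises either from a derivation applied after
its first letter [c], or from a letter [a] whose image contains [c d]. *)
Fixpoint derU (x : letter) f (U : word) : K :=
  if U is c :: U' then
    derU x (fun u => f (c :: u)) U' +
    (if U' is d :: U'' then \sum_a bracket_coef x a c d * f (a :: U'') else 0)
  else 0.

(** The action of [x] on U (x) V: [x, U] (x) V + U (x) x V. *)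
Definition derUV (x : letter) m : UVmod := fun p =>
  derU x (fun U => m (U, p.2)) p.1 +
  (if p.2 is c :: V then (c == x)%:R * m (p.1, V) else 0).

Lemma derU_linear x k f g U :
  derU x (fun u => k * f u + g u) U = k * derU x f U + derU x g U.
Proof.
elim: U f g => [|c U IH] f g /=; first by rewrite mulr0 addr0.
rewrite (IH (fun u => f (c :: u)) (fun u => g (c :: u))) mulrDr addrACA.
congr (_ + _); case: U {IH} => [|d U]; first by rewrite mulr0 addr0.
rewrite mulr_sumr -big_split /=; apply: eq_bigr => a _.
by rewrite mulrDr mulrCA.
Qed.

Lemma derU_scale x k f U : derU x (fun u => k * f u) U = k * derU x f U.
Proof.
elim: U f => [|c U IH] f /=; first by rewrite mulr0.
rewrite (IH (fun u => f (c :: u))) mulrDr; congr (_ + _).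
case: U {IH} => [|d U]; first by rewrite mulr0.
by rewrite mulr_sumr; apply: eq_bigr => a _; rewrite mulrCA.
Qed.

Lemma derU_eq0 x f U : (forall c u, f (c :: u) = 0) -> derU x f U = 0.
Proof.
elim: U f => //= c U IH f f0; rewrite IH ?add0r; last by move=> d u; exact: f0.
by case: U {IH} => // d U; rewrite big1// => a _; rewrite f0 mulr0.
Qed.

Definition letter_op (a : letter) : UVmod -> UVmod :=
  if a is (X12 | X23) then derUV a else lmulU a.

Lemma letter_op_linear a : linear (letter_op a).
Proof.
have lU : linear (lmulU a).
  move=> k m n; apply/funext => -[[|c U] V];
    rewrite /lmulU /= !fctE /= ?scaler0 ?addr0//.
  by rewrite mulrDr /GRing.scale /= mulrCA.
have lD : linear (derUV a).
  move=> k m n; apply/funext => -[U V]; rewrite /derUV /= !fctE /=.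
  rewrite derU_linear {2}/GRing.scale /= mulrDr addrACA; congr (_ + _).
  case: V => [|c V]; rewrite ?mulr0 ?addr0//.
  by rewrite mulrDr /GRing.scale /= mulrCA.
by case: a lU lD.
Qed.
HB.instance Definition _ a :=
  GRing.isLinear.Build K UVmod UVmod *:%R (letter_op a) (letter_op_linear a).

(** The Leibniz rule for the product of the letter [a] with a word. *)
Lemma derUV_lmulU x a m U V :
  derUV x (lmulU a m) (U, V) = lmulU a (derUV x m) (U, V) +
  (if U is c :: d :: U' then bracket_coef x a c d * m (U', V) else 0).
Proof.
rewrite /derUV /lmulU /=; case: U => [|c U].
  by rewrite /= !addr0 add0r; case: V => // c V; rewrite mulr0.
rewrite /= derU_scale mulrDr -!addrA; congr (_ + _); rewrite addrC.
congr (_ + _); first by case: V => [|d V]; rewrite ?mulr0// mulrCA.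
case: U => // d U; rewrite (bigD1 a)//= eqxx mul1r big1 ?addr0// => b ba.
by rewrite (negPf ba) mul0r mulr0.
Qed.

(** The equality of letters is inherited from that of ordinals, through codes
that do not reduce. *)
Lemma letter_eqE (a b : letter) : (a == b) =
  match a, b with
  | X34, X34 | X45, X45 | X24, X24 | X12, X12 | X23, X23 => true
  | _, _ => false
  end.
Proof. by case: a; case: b; apply/eqP. Qed.

(** All the relations of UB_5 between the five letters.  They are oriented so
that X12 and X23 move to the right, which leaves independent products only. *)
Lemma letter_op_comm m p (A := fun a b => letter_op a (letter_op b m) p : K) :
  [/\ A X12 X34 = A X34 X12,
      A X12 X45 = A X45 X12,
      A X23 X45 = A X45 X23,
      A X23 X24 = A X24 X23 + A X24 X34 - A X34 X24 &
      A X23 X34 = A X34 X23 + A X34 X24 - A X24 X34] /\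
  A X12 X24 = A X24 X12 + A X34 X24 + A X45 X24 - A X24 X34 - A X24 X45.
Proof.
pose s := (mulr0, mul0r, mulr1, mul1r, add0r, addr0, mulN1r, oppr0, sub0r,
  subr0).
rewrite {}/A /letter_op; case: p => U V.
do !split; rewrite derUV_lmulU; move: (derUV _ _) => D; rewrite /lmulU;
  case: U => [|c [|d U]]; rewrite /= ?s ?letter_eqE//;
  case: c; case: d => /=; rewrite ?s//; ring.
Qed.

(** Linear combinations of the letters X34, X45, X24, X12, X23, in this order,
with integer coefficients so that relations between them can be decided by
computation. *)
Definition letter_vec := (int * int * int * int * int)%type.

Definition letter_coord (v : letter_vec) (a : letter) : int :=
  let: (x34, x45, x24, x12, x23) := v in
  match a with
  | X34 => x34 | X45 => x45 | X24 => x24 | X12 => x12 | X23 => x23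
  end.

(** The ten X_ij solve the linear relations sum_j X_ij = 0: for instance X_51
= X_23 + X_24 + X_34, because the generators with both indices in a set and
those with both indices in its complement have the same sum. *)
Definition idx_vec (p : idx * idx) : letter_vec :=
  match nat_of_ord p.1, nat_of_ord p.2 with
  | 3, 4 | 4, 3 => (1, 0, 0, 0, 0)%R
  | 4, 0 | 0, 4 => (0, 1, 0, 0, 0)%R
  | 2, 4 | 4, 2 => (0, 0, 1, 0, 0)%R
  | 1, 2 | 2, 1 => (0, 0, 0, 1, 0)%R
  | 2, 3 | 3, 2 => (0, 0, 0, 0, 1)%R
  | 1, 3 | 3, 1 => (0, 1, 0, -1, -1)%R
  | 1, 4 | 4, 1 => (-1, -1, -1, 0, 0)%R
  | 1, 0 | 0, 1 => (1, 0, 1, 0, 1)%R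
  | 2, 0 | 0, 2 => (0, 0, -1, -1, -1)%R
  | 3, 0 | 0, 3 => (-1, -1, 0, 1, 0)%R
  | _, _ => (0, 0, 0, 0, 0)%R
  end%N.

Definition vec_op (v : letter_vec) m : UVmod :=
  \sum_a (letter_coord v a)%:~R *: letter_op a m.

Lemma sum_letter (V : nmodType) (F : letter -> V) :
  \sum_a F a = F X34 + F X45 + F X24 + F X12 + F X23.
Proof.
rewrite (bigD1 X34)//= (bigD1 X45) ?letter_eqE//= (bigD1 X24) ?letter_eqE//=.
rewrite (bigD1 X12) ?letter_eqE//= (bigD1 X23) ?letter_eqE//=.
by rewrite big1 ?addr0 ?addrA// => -[]; rewrite !letter_eqE.
Qed.

Lemma vec_op_linear v : linear (vec_op v).
Proof.
move=> k m n; rewrite /vec_op scaler_sumr -big_split /=; apply: eq_bigr => a _.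
by rewrite linearP scalerDr !scalerA mulrC.
Qed.
HB.instance Definition _ v :=
  GRing.isLinear.Build K UVmod UVmod *:%R (vec_op v) (vec_op_linear v).

Lemma vec_op_point v m p : vec_op v m p =
  \sum_a (letter_coord v a)%:~R * letter_op a m p :> K.
Proof. by rewrite /vec_op fct_sumE. Qed.

Definition minor (v w : letter_vec) (a b : letter) : int :=
  letter_coord v a * letter_coord w b - letter_coord v b * letter_coord w a.

(** Modulo the relations of [letter_op_comm], the bracket of [v] and [w] is a
combination of [X24,X34], [X24,X45], [X34,X45] and [X12,X23]; its four
coordinates are required to vanish. *)
Definition commuting_vecs (v w : letter_vec) : bool :=
  [&& minor v w X24 X34 + minor v w X23 X24 - minor v w X23 X34
        - minor v w X12 X24 == 0,
      minor v w X24 X45 - minor v w X12 X24 == 0,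
      minor v w X34 X45 == 0 & minor v w X12 X23 == 0].

Lemma vec_op_comm v w m : commuting_vecs v w ->
  vec_op v (vec_op w m) = vec_op w (vec_op v m).
Proof.
have E u u' p : vec_op u (vec_op u' m) p = \sum_a \sum_b
    (letter_coord u a)%:~R * ((letter_coord u' b)%:~R *
       (letter_op a (letter_op b m) p : K)) :> K.
  rewrite vec_op_point; apply: eq_bigr => a _.
  rewrite {1}/vec_op linear_sum fct_sumE mulr_sumr; apply: eq_bigr => b _.
  by rewrite linearZ.
move=> /and4P[/eqP h1 /eqP h2 /eqP h3 /eqP h4]; apply/funext => p.
apply/eqP; rewrite -subr_eq0; apply/eqP; rewrite !E !sum_letter.
have [[r1 r2 r3 r4 r5] r6] := letter_op_comm m p.
rewrite r1 r2 r3 r4 r5 r6.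
pose A a b : K := letter_op a (letter_op b m) p.
transitivity (
  (minor v w X24 X34 + minor v w X23 X24 - minor v w X23 X34
        - minor v w X12 X24)%:~R * (A X24 X34 - A X34 X24) +
  (minor v w X24 X45 - minor v w X12 X24)%:~R * (A X24 X45 - A X45 X24) +
  (minor v w X34 X45)%:~R * (A X34 X45 - A X45 X34) +
  (minor v w X12 X23)%:~R * (A X12 X23 - A X23 X12)); last first.
  by rewrite h1 h2 h3 h4 !mul0r !addr0.
by rewrite /A /minor; ring.
Qed.

Definition idx_op (p : idx * idx) : {linear UVmod -> UVmod} :=
  vec_op (idx_vec p).

Lemma idx_op_letter a : idx_op (letter_idx a) =1 letter_op a.
Proof.
move=> m; rewrite /idx_op /= /vec_op sum_letter.
case: a => /=; by rewrite !scale0r scale1r ?add0r ?addr0.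
Qed.

Lemma idx_vec_comm (i j k l : idx) : i != k -> i != l -> j != k -> j != l ->
  commuting_vecs (idx_vec (i, j)) (idx_vec (k, l)).
Proof.
by elim/chord_ind: i; elim/chord_ind: j; elim/chord_ind: k; elim/chord_ind: l.
Qed.

End SemidirectModule.

(** * Coordinates in the basis B_4 *)

Section Coordinates.
Variable K : comNzRingType.
Local Notation M := (UVmod K).
Local Notation lser := (Defs.series K letter).

Definition letter_act (a : letter) : {linear M -> M} := letter_op (K := K) a.

Definition delta (q : word * word) : M := fun p => (p == q)%:R.

Definition in_U (a : letter) : bool := a \in [:: X24; X34; X45].

Definition UV_split (b : word) : word * word :=
  ([seq a <- b | in_U a], [seq a <- b | ~~ in_U a]).

Lemma in_V a : (a \in [:: X12; X23]) = ~~ in_U a.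
Proof. by case: a; rewrite /in_U /= !inE !letter_eqE. Qed.

Lemma B4_split b : B4 b ->
  [/\ all in_U (UV_split b).1, all (predC in_U) (UV_split b).2
    & b = (UV_split b).1 ++ (UV_split b).2].
Proof.
move=> [U [V [hU hV ->]]].
have hV' : all (predC in_U) V.
  by rewrite -(eq_all (a1 := mem [:: X12; X23]))// => a; exact: in_V.
rewrite /UV_split !filter_cat /=.
have -> : [seq a <- U | ~~ in_U a] = [::].
  by apply/eqP; rewrite -(negbK (_ == _)) -has_filter has_predC hU.
have -> : [seq a <- V | in_U a] = [::].
  apply/eqP; rewrite -(negbK (_ == _)) -has_filter.
  rewrite -(eq_has (a1 := predC (predC in_U))) ?has_predC ?hV'// => a /=.
  by rewrite negbK.
rewrite cats0 (all_filterP hU) (all_filterP hV'); by split.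
Qed.

Lemma letter_act_delta_U a U V : in_U a ->
  letter_act a (delta (U, V)) = delta (a :: U, V).
Proof.
move=> aU; rewrite /letter_act /= (_ : letter_op a _ = lmulU a (delta (U, V))).
  apply/funext => -[[|c U'] V'] //=; rewrite /lmulU /delta /= -natrM mulnb.
  by rewrite -!pair_eqE /= eqseq_cons andbA.
by move: aU; case: (a) => //; rewrite /in_U /= !inE !letter_eqE.
Qed.

(** The derivation of [a] kills the empty word, so only the left
multiplication remains. *)
Lemma letter_act_delta_V a V : ~~ in_U a ->
  letter_act a (delta ([::], V)) = delta ([::], a :: V).
Proof.
move=> aV; rewrite /letter_act /=.
rewrite (_ : letter_op a _ = derUV a (delta ([::], V))).
  apply/funext => -[U' V']; rewrite /derUV /= derU_eq0 ?add0r; last first.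
    by move=> c u; rewrite /delta.
  case: V' => [|c V']; rewrite /delta -!pair_eqE /= ?andbF//.
  by rewrite -natrM mulnb eqseq_cons andbCA.
by move: aV; case: (a) => //; rewrite /in_U /= !inE !letter_eqE.
Qed.

Lemma word_act_B4 b : B4 b ->
  word_act letter_act b (delta ([::], [::])) = delta (UV_split b).
Proof.
move=> /B4_split; case: (UV_split b) => U V /= [hU hV ->].
elim: U hU => [|a U IH] /= => [_|/andP[aU hU]]; last first.
  by rewrite IH// letter_act_delta_U.
elim: V hV => //= a V IH /andP[aV hV].
by rewrite IH// letter_act_delta_V.
Qed.

Lemma vec_op0 (m : M) : vec_op (0, 0, 0, 0, 0) m = 0.
Proof. by rewrite /vec_op big1// => -[] _ /=; rewrite scale0r. Qed.

Lemma ser_mul_mono1 (A : eqType) (p : A) w :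
  ser_mul (ser_mono K [:: p]) (ser_mono K w) = ser_mono K (p :: w).
Proof.
apply/funext => -[|a v]; first by rewrite /ser_mul big_ord1 /ser_mono mul0r.
rewrite ser_mul_cons mul0r add0r.
transitivity (ser_mul (fun v => (a == p)%:R * (v == [::])%:R) (ser_mono K w) v).
  apply: eq_bigr => k _; congr (_ * _).
  by rewrite /ser_mono eqseq_cons -natrM mulnb.
by rewrite ser_mul_constl /ser_mono eqseq_cons -natrM mulnb.
Qed.

(** The relations are homogeneous of degree 1 or 2, so each reduces to a
linear relation between the [idx_vec], or to [vec_op_comm]. *)
Lemma act_UB5_rel g n (m : M) : UB5_rel g -> act (@idx_op K) n g m = 0.
Proof.
case.
- move=> i; rewrite act_mono /= /idx_op /=.
  have -> : idx_vec (i, i) = (0, 0, 0, 0, 0) by elim/chord_ind: i.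
  by rewrite vec_op0 scaler0.
- move=> i j; rewrite act_subl !act_mono /= /idx_op /=.
  have -> : idx_vec (i, j) = idx_vec (j, i).
    by elim/chord_ind: i; elim/chord_ind: j.
  by rewrite subrr.
- move=> i; transitivity (act (@idx_op K) n
      (fun w => \sum_(j : 'Z_5) 1 * Xgen K i j w) m).
    by apply: eq_act => w _; apply: eq_bigr => j _; rewrite mul1r.
  rewrite act_suml; under eq_bigr do rewrite scale1r act_mono /=.
  rewrite -scaler_sumr /= /vec_op exchange_big big1 ?scaler0//= => a _.
  rewrite -scaler_suml -rmorph_sum /=.
  rewrite (_ : \sum_(j : 'Z_5) _ = 0) ?scale0r//.
  by rewrite !big_ord_recl big_ord0; elim/chord_ind: i; case: a.
- move=> i j k l ik il jk jl.
  rewrite /Xgen !ser_mul_mono1 act_subl !act_mono /=.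
  by rewrite /idx_op /= vec_op_comm ?subrr//; exact: idx_vec_comm.
Qed.

Lemma act_eqUB5 f g n (m : M) : eqUB5 f g ->
  act (@idx_op K) n f m = act (@idx_op K) n g m.
Proof.
move=> fg; apply/eqP; rewrite -subr_eq0 -act_subl; apply/eqP.
by apply: act_closed_ideal fg => h k u; exact: act_UB5_rel.
Qed.

Lemma act_emb n f (m : M) : act (@idx_op K) n (emb f) m = act letter_act n f m.
Proof.
have wE W : word_act (@idx_op K) (map letter_idx W) m = word_act letter_act W m.
  by elim: W => //= a W ->; exact: idx_op_letter.
transitivity (act (@idx_op K) n (fun v => \sum_(W : n.-tuple letter)
    f W * ser_mono K (map letter_idx W) v) m); last first.
  rewrite act_suml actE; apply: eq_bigr => W _.
  by rewrite act_mono size_map size_tuple eqxx scale1r wE.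
apply: eq_act => v vn; case: (embP v) => [W e|h]; last first.
  rewrite emb_out// big1// => W _.
  rewrite /ser_mono; case: eqP; rewrite ?mulr0//.
  by move/h.
have Wn : size W == n by rewrite -vn e size_map.
rewrite e emb_map (bigD1 (Tuple Wn))//= big1 ?addr0.
  by rewrite /ser_mono eqxx mulr1.
move=> W' W'W; rewrite /ser_mono (inj_eq (inj_map letter_idx_inj)).
case: eqP; rewrite ?mulr0// => e'.
by case/eqP: W'W; apply/val_inj.
Qed.

Lemma B4_series_emb (a : word -> K) :
  B4_series a = emb (fun W => if `[< B4 W >] then a W else 0).
Proof.
apply/funext => v; rewrite /B4_series; case: (embP v) => [W ->|h]; last first.
  rewrite emb_out// (_ : _ `&` _ = set0) ?fsbig_set0//.
  by apply/seteqP; split => // b [_ /= /esym /h].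
rewrite emb_map; case: asboolP => BW.
  rewrite (_ : _ `&` _ = [set W]) ?fsbig_set1//.
  apply/seteqP; split => [b [_ /= /(inj_map letter_idx_inj)]|b ->] //=.
rewrite (_ : _ `&` _ = set0) ?fsbig_set0//.
apply/seteqP; split => // b [Bb /= /(inj_map letter_idx_inj) e].
by apply: BW; rewrite -e.
Qed.

Lemma UV_split_inj b b' : B4 b -> B4 b' ->
  (UV_split b == UV_split b') = (b == b').
Proof.
move=> /B4_split[_ _ e] /B4_split[_ _ e']; apply/eqP/eqP => [h|-> //].
by rewrite e e' h.
Qed.

(** This is the linear independence of B_4: a series supported on B_4 can be
recovered from its action on 1 (x) 1. *)
Lemma act_B4_series n f b : B4 b ->
  act letter_act n (fun W => if `[< B4 W >] then f W else 0)
    (delta ([::], [::])) (UV_split b) = if n == size b then f b else 0 :> K.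
Proof.
move=> Bb; rewrite actE fct_sumE.
transitivity (\sum_(W : n.-tuple letter) (val W == b)%:R * f b : K).
  apply: eq_bigr => W _; case: asboolP => BW; last first.
    rewrite scale0r; case: eqP => [e|]; rewrite ?mul0r//.
    by case: BW; rewrite e.
  rewrite word_act_B4// -[LHS]/(f W * (UV_split b == UV_split W)%:R).
  rewrite UV_split_inj// eq_sym.
  by case: eqP => [->|]; rewrite ?mulr1 ?mul1r ?mulr0 ?mul0r.
case: eqP => [nb|nb].
  have sb : size b == n by rewrite nb.
  rewrite (bigD1 (Tuple sb))//= eqxx mul1r big1 ?addr0// => W Wb.
  case: eqP => [e|]; rewrite ?mul0r//; case/eqP: Wb; exact/val_inj.
rewrite big1// => W _; case: eqP => [e|]; rewrite ?mul0r//.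
by case: nb; rewrite -e size_tuple.
Qed.

(** Both sides of W = sum_b l_{b,W} b act in the same way on 1 (x) 1. *)
Lemma B4_coordE (l : word -> word -> K) b W : is_B4_coord l -> B4 b ->
  l b W = (size W == size b)%:R *
    (word_act letter_act W (delta ([::], [::])) (UV_split b) : K).
Proof.
move=> /(_ W) hl Bb.
have := act_eqUB5 (size b) (delta ([::], [::])) hl.
rewrite act_mono B4_series_emb act_emb => /(congr1 (@^~ (UV_split b))).
rewrite act_B4_series// eqxx => <-; rewrite size_map eq_sym.
have -> // : word_act (@idx_op K) (map letter_idx W) (delta ([::], [::])) =
    word_act letter_act W (delta ([::], [::])).
by elim: W {hl} => //= a W ->; exact: idx_op_letter.
Qed.

Lemma fsbig_B4_coord (l : word -> word -> K) (c : lser) b :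
  is_B4_coord l -> B4 b ->
  \sum_(W \in [set: word]) l b W * c W =
  \sum_(W : (size b).-tuple letter) l b W * c W.
Proof.
move=> hl Bb.
transitivity (\sum_(W <- [seq val t | t <- enum {: (size b).-tuple letter}])
    l b W * c W); last by rewrite big_map big_enum.
rewrite [RHS]fsbig_seq; last first.
  by rewrite map_inj_uniq ?enum_uniq//; exact: val_inj.
apply/esym/fsbig_widen => // W [_] /= hW.
rewrite (B4_coordE W hl Bb); case: eqP => [e|]; last by rewrite !mul0r.
case: hW; apply/mapP.
have sW : size W == size b by rewrite e.
by exists (Tuple sW); rewrite ?mem_enum.
Qed.

Lemma act_B4_coord (l : word -> word -> K) (c : lser) b :
  is_B4_coord l -> B4 b ->
  act (@idx_op K) (size b) (emb c) (delta ([::], [::])) (UV_split b) =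
  \sum_(W \in [set: word]) l b W * c W :> K.
Proof.
move=> hl Bb; rewrite fsbig_B4_coord// act_emb actE fct_sumE.
apply: eq_bigr => W _.
by rewrite (B4_coordE W hl Bb) size_tuple eqxx mul1r mulrC.
Qed.

(** From left to right both sides act on 1 (x) 1.  From right to left, the
words of length at most n are replaced by their expansions in B_4, which
involve words of the same length only; what remains below degree n is the
constant term 1. *)
Lemma eqUB5_one_coord (l : word -> word -> K) (c : lser) :
  is_B4_coord l -> c [::] = 1 ->
  eqUB5 (emb c) (@ser_one K _) <->
  forall b, B4 b -> b <> [::] -> \sum_(W \in [set: word]) l b W * c W = 0.
Proof.
move=> hl c1; split=> [h b Bb b0|h].
  rewrite -act_B4_coord// (act_eqUB5 _ _ h) act_mono /=.
  by case: b b0 {Bb} => // a b _; rewrite scale0r.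
apply: closed_ideal_lim => n.
exists (fun v => \sum_(k < n.+1) \sum_(W : k.-tuple letter)
    c W * ser_sub (word_series K W) (B4_series (l^~ W)) v).
  apply: closed_ideal_sum => k _; apply: closed_ideal_sum => W _.
  exact/closed_idealZ/hl.
move=> v vn; rewrite /ser_sub /word_series.
under eq_bigr do under eq_bigr do rewrite mulrBr B4_series_emb -emb_mono.
case: (embP v) => [W0 e|hv]; last first.
  rewrite big1 ?emb_out// => [|k _]; last first.
    by rewrite big1// => W _; rewrite !emb_out// mulr0 subrr.
  by rewrite /ser_one -(emb_mono _ [::]) emb_out// subrr.
rewrite e /ser_one -(emb_mono _ [::]) !emb_map.
have W0n : (size W0 < n.+1)%N by rewrite ltnS -(size_map letter_idx) -e.
under eq_bigr do rewrite sumrB; rewrite sumrB; congr (_ - _).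
  rewrite (bigD1 (Ordinal W0n))//= [X in _ + X]big1 ?addr0; last first.
    move=> k kW; rewrite big1// => W _.
    rewrite emb_map /ser_mono; case: eqP => [e'|].
      by case/eqP: kW; apply/val_inj; rewrite /= e' size_tuple.
    by rewrite mulr0.
  rewrite (bigD1 (in_tuple W0))//= emb_map /ser_mono eqxx mulr1 big1 ?addr0//.
  move=> W WW0; rewrite emb_map; case: eqP; rewrite ?mulr0// => e'.
  by case/eqP: WW0; apply/val_inj.
case: (asboolP (B4 W0)) => BW0; last first.
  transitivity (0 : K); last first.
    rewrite big1// => k _; rewrite big1// => W _; rewrite emb_map.
    by case: asboolP => //; rewrite mulr0.
  rewrite /ser_mono; case: eqP => // W00; case: BW0.
  by exists [::], [::]; split.
rewrite (bigD1 (Ordinal W0n))//= [X in _ + X]big1 ?addr0; last first.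
  move=> k kW; rewrite big1// => W _; rewrite emb_map asboolT//.
  rewrite (B4_coordE W hl BW0) size_tuple.
  case: eqP => [ke|]; last by rewrite mul0r mulr0.
  by case/eqP: kW; apply/val_inj.
transitivity (\sum_(W \in [set: word]) l W0 W * c W); last first.
  rewrite fsbig_B4_coord//; apply: eq_bigr => W _.
  by rewrite emb_map asboolT// mulrC.
rewrite /ser_mono; case: eqP => [->|W00]; last by rewrite h.
rewrite fsbig_B4_coord; last by exists [::], [::]; split.
  rewrite (bigD1 [tuple])//= big1 ?addr0; last first.
    by move=> t; rewrite [t]tuple0 => /eqP.
  rewrite (B4_coordE _ hl) /= ?c1 ?mulr1 ?mul1r /delta ?eqxx//.
  by exists [::], [::]; split.
exact: hl.
Qed.

End Coordinates.

(** * The integral along gamma *)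

Section LineIntegral.
Variables (R : realType) (r : letter -> option bool) (nu : letter -> lform R).
Hypothesis nuE : forall x y, nu x y = (r x == Some y)%:R.

Lemma prod_nth_rho (U : word) (w : seq bool) : size w = size U ->
  \prod_(k < size (map nu U)) nth (fun=> 0) (map nu U) k (nth false w k) =
  (rho_word r U == Some w)%:R.
Proof.
elim: U w => [|x U IH] [|y w] //=; first by rewrite big_ord0.
move=> [wU]; rewrite big_ord_recl /= nuE IH//.
case: (r x) => [b|] /=; last by rewrite mul0r.
case: (rho_word r U) => [u|]; last by rewrite mulr0.
by rewrite -natrM mulnb /eq_op /= -/eq_op.
Qed.

Lemma line_integral_rho (I : seq bool -> R) (U : word) :
  line_integral I (map nu U) =
  if rho_word r U is Some w then (I w)%:C%C else 0.
Proof.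
rewrite /line_integral.
transitivity (\sum_(w : (size (map nu U)).-tuple bool)
    (rho_word r U == Some (val w))%:R * (I w)%:C%C).
  apply: eq_bigr => w _; congr (_ * _).
  rewrite -prod_nth_rho ?size_tuple ?size_map//.
  by apply: eq_bigr => k _; rewrite (tnth_nth false).
case: (rho_word r U) (@size_rho_word r U) => [w|] hsz; last first.
  by rewrite big1// => w _; rewrite mul0r.
have sw : size w == size (map nu U) by rewrite size_map (hsz _ erefl).
rewrite (bigD1 (Tuple sw))//= eqxx mul1r big1 ?addr0// => u uw.
case: eqP => [[e]|]; last by rewrite mul0r.
by case/eqP: uw; apply/val_inj; rewrite /= e.
Qed.

End LineIntegral.

Lemma gamma_factor (R : realType) (z I : seq bool -> R) (k : 'I_5) (U : word) :
  is_zeta_sh z -> is_reg_integral I ->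
  line_integral I [seq Reg (tnth gamma k) (omega R x) | x <- U] =
  signed_zeta z (rho_word (tnth rhos k) U).
Proof.
move=> hz hI; rewrite (line_integral_rho (Reg_omega R k)) /signed_zeta.
case: rho_word => // w; rewrite (reg_integral_zeta w hz hI).
by rewrite rmorphM rmorphXn rmorphN1.
Qed.

Lemma relation_lhs_gamma_integral (R : realType) (z I : seq bool -> R)
    (l : word -> word -> R[i]) b : is_zeta_sh z -> is_reg_integral I ->
  relation_lhs z l b = gamma_integral I (dual_B4 l b).
Proof.
move=> hz hI; apply: eq_fsbigr => W _; congr (_ * _).
apply: eq_fsbigr => U _; apply: eq_bigr => k _.
by rewrite (gamma_factor _ _ hz hI).
Qed.

(** * The pentagon relation as a series in the five letters *)

Section Factorizations.
Variables (K : comNzRingType) (A : choiceType).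
Local Notation ser := (Defs.series K A).

(** An explicit enumeration of the factorizations of [W], following the
recursion of the product of series. *)
Fixpoint splittings (n : nat) (W : seq A) : seq (n.-tuple (seq A)) :=
  if n is n'.+1 then
    [seq cons_tuple (take k W) (U : n'.-tuple (seq A))
       | k <- iota 0 (size W).+1, U <- splittings n' (drop k W)]
  else if W == [::] then [:: [tuple]] else [::].

Lemma splittingsS n W : splittings n.+1 W =
  [seq cons_tuple (take k W) U | k <- iota 0 (size W).+1,
                                 U <- splittings n (drop k W)].
Proof. by []. Qed.

Lemma mem_splittings n W (U : n.-tuple (seq A)) :
  (U \in splittings n W) = (flatten U == W).
Proof.
elim: n W U => [|n IH] W U.
  rewrite [U]tuple0 /= [RHS](eq_sym [::]).
  by case: (W == [::]) => //=; apply/eqP.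
rewrite splittingsS; apply/flatten_mapP/eqP => [[k _ /mapP[V]]|].
  by rewrite IH => /eqP e -> /=; rewrite e cat_take_drop.
case/tupleP: U => V U e; have {}e : V ++ flatten U = W by [].
exists (size V).
  by rewrite mem_iota /= add0n ltnS -e size_cat leq_addr.
apply/mapP; exists U; first by rewrite IH -e drop_size_cat.
by apply/val_inj; rewrite /= -e take_size_cat.
Qed.

Lemma uniq_splittings n W : uniq (splittings n W).
Proof.
elim: n W => [|n IH] W; first by rewrite /=; case: ifP.
rewrite splittingsS; apply: allpairs_uniq_dep.
- exact: iota_uniq.
- by move=> k _; exact: IH.
move=> p q.
have tag_le u : u \in [seq @Tagged nat k (fun=> n.-tuple (seq A)) V
    | k <- iota 0 (size W).+1, V <- splittings n (drop k W)] ->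
    (tag u <= size W)%N.
  by move=> /flatten_mapP[k + /mapP[V _ ->]]; rewrite mem_iota add0n ltnS /=.
move=> /tag_le + /tag_le.
case: p q => k U [k' U'] /= kW k'W /(congr1 val) [e1 e2].
have e : k = k' by rewrite -(size_takel kW) e1 size_takel.
by rewrite e in U e2 *; congr existT; apply/val_inj.
Qed.

Lemma fsbig_flatten n (F : 'I_n -> ser) W :
  \sum_(U \in [set U : n.-tuple (seq A) | flatten U = W])
     \prod_(i < n) F i (tnth U i) =
  (\big[@ser_mul K A/@ser_one K A]_(i < n) F i) W.
Proof.
transitivity (\sum_(U <- splittings n W) \prod_(i < n) F i (tnth U i)).
  rewrite [RHS]fsbig_seq ?uniq_splittings//; congr (\sum_(U \in _) _).
  apply/seteqP; split => U /=; first by move=> /eqP; rewrite -mem_splittings.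
  by rewrite mem_splittings => /eqP.
elim: n F W => [|n IH] F W.
  rewrite /= big_ord0 /ser_one /ser_mono; case: eqP => _.
    by rewrite big_cons big_nil big_ord0 addr0.
  by rewrite big_nil.
rewrite splittingsS big_allpairs_dep big_ord_recl.
rewrite -[RHS](big_mkord xpredT (fun k => F ord0 (take k W) *
  (\big[@ser_mul K A/@ser_one K A]_(i < n) F (lift ord0 i)) (drop k W))).
rewrite /index_iota subn0; apply: eq_bigr => k _.
rewrite -IH mulr_sumr; apply: eq_bigr => U _.
rewrite big_ord_recl tnth0; congr (_ * _).
by apply: eq_bigr => i _; rewrite tnthS.
Qed.

End Factorizations.

Section Pentagon.
Variable K : comNzRingType.
Local Notation iser := (Defs.series K (idx * idx)%type).
Local Notation cid := (closed_ideal (@UB5_rel K)).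

Lemma ser_mulr1 (A : eqType) (f : Defs.series K A) :
  ser_mul f (@ser_one K A) = f.
Proof.
apply/funext => w; elim: w f => [|a w IH] f.
  by rewrite /ser_mul big_ord1 /ser_one /ser_mono mulr1.
by rewrite ser_mul_cons IH /ser_one /ser_mono mulr0 add0r.
Qed.

Lemma emb_letters_over1 r x a : (forall b, (r b == Some x) = (b == a)) ->
  emb (letters_over K r x) = Xgen K (letter_idx a).1 (letter_idx a).2.
Proof.
move=> h; rewrite /Xgen -surjective_pairing -(emb_mono K [:: a]); congr emb.
apply/funext => -[|b [|c W]] //=; rewrite /ser_mono.
  by rewrite h eqseq_cons andbT.
by rewrite eqseq_cons andbF.
Qed.

Lemma sum_idx (V : nmodType) (F : idx -> V) :
  \sum_(j : 'Z_5) F j = F 5 + F 1 + F 2 + F 3 + F 4.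
Proof.
rewrite !big_ord_recl big_ord0 addr0 !addrA.
by do !congr (_ + _); congr F; apply/val_inj.
Qed.

(** Up to symmetry and X_ii = 0, adding the relations sum_j X_ij = 0 for i =
1, 5 and subtracting those for i = 2, 3, 4 gives 2 X_51 - 2 (X_23 + X_24 +
X_34), whence the need for 1/2. *)
Lemma eqUB5_X51 (half : K) r x : half * 2 = 1 ->
  (forall a, (r a == Some x) = (a \in [:: X23; X34; X24])) ->
  eqUB5 (Xgen K 5 1) (emb (letters_over K r x)).
Proof.
move=> h2 rE; rewrite /eqUB5.
have dI i : cid (Xgen K i i) by apply/closed_ideal_gen/UB5_diag.
have tI i j : cid (ser_sub (Xgen K i j) (Xgen K j i)).
  by apply/closed_ideal_gen/UB5_sym.
have sI i : cid (fun w => \sum_(j : 'Z_5) Xgen K i j w).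
  by apply/closed_ideal_gen/UB5_sum.
have NI f : cid f -> cid (fun w => - f w).
  by move=> /(closed_idealZ (-1)); under eq_fun do rewrite mulN1r.
have embE : emb (letters_over K r x) =
    fun w => Xgen K 2 3 w + Xgen K 3 4 w + Xgen K 2 4 w.
  apply/funext => w; rewrite /Xgen -(emb_mono K [:: X23]).
  rewrite -(emb_mono K [:: X34]) -(emb_mono K [:: X24]).
  case: (embP w) => [W ->|h]; last first.
    by rewrite !emb_out// !addr0.
  rewrite !emb_map /ser_mono; case: W => [|b [|c W]] /=; rewrite ?addr0//.
    rewrite rE !inE !eqseq_cons !andbT.
    by case: b; rewrite !letter_eqE/= ?addr0 ?add0r.
  by rewrite !eqseq_cons !andbF !addr0.
have := closed_idealZ half (closed_idealD (closed_idealD (closed_idealD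
  (closed_idealD (closed_idealD (closed_idealD (sI 1) (sI 5))
     (closed_idealD (NI _ (sI 2)) (closed_idealD (NI _ (sI 3)) (NI _ (sI 4)))))
  (closed_idealD (closed_idealD (NI _ (dI 1)) (NI _ (dI 5)))
     (closed_idealD (dI 2) (closed_idealD (dI 3) (dI 4)))))
  (closed_idealD (tI 2 1) (closed_idealD (tI 3 1) (tI 4 1))))
  (closed_idealD (tI 2 5) (closed_idealD (tI 3 5) (tI 4 5))))
  (closed_idealD (tI 5 1) (closed_idealD (tI 3 2)
     (closed_idealD (tI 4 2) (tI 4 3))))).
congr cid; apply/funext => w.
rewrite embE /ser_sub !sum_idx; move: (Xgen K) => X.
transitivity (half * 2 * (X 5 1 w - (X 2 3 w + X 3 4 w + X 2 4 w))); first ring.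
by rewrite h2 mul1r.
Qed.

End Pentagon.

Section PentagonSeries.
Variable K : comNzRingType.
Local Notation iser := (Defs.series K (idx * idx)%type).

Lemma eqUB5_refl (f : iser) : eqUB5 f f.
Proof. exact: closed_ideal_subr. Qed.

Lemma eqUB5_sym (f g : iser) : eqUB5 f g -> eqUB5 g f.
Proof.
move=> /(closed_idealZ (-1)); congr closed_ideal; apply/funext => w.
by rewrite /ser_sub mulN1r opprB.
Qed.

Lemma eqUB5_trans (f g h : iser) : eqUB5 f g -> eqUB5 g h -> eqUB5 f h.
Proof.
move=> fg gh; have := closed_idealD fg gh; congr closed_ideal.
by apply/funext => w; rewrite /ser_sub addrA subrK.
Qed.

Lemma eqUB5_subst phi r (A B : iser) : A [::] = 0 -> B [::] = 0 ->
  eqUB5 A (emb (letters_over K r false)) ->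
  eqUB5 B (emb (letters_over K r true)) ->
  eqUB5 (ser_subst phi A B)
    (emb (fun W => if rho_word r W is Some w then phi w else 0)).
Proof.
move=> A0 B0 hA hB.
rewrite (_ : (fun W => _) =
    ser_subst phi (letters_over K r false) (letters_over K r true)); last first.
  by apply/funext => W; rewrite ser_subst_letters_over.
rewrite emb_subst.
apply: (@ser_subst_congr _ _ _ phi (fun x => if x then B else A)
  (fun x => emb (letters_over K r x))); by case.
Qed.

End PentagonSeries.

Section PentagonCoordinates.
Variables (R : realType) (zsh : seq bool -> R).
Local Notation C := R[i].

(** The sums over factorizations of a word are the coefficients of a product
of five series, by [fsbig_flatten]. *)
Definition pentagon_coef : Defs.series C letter :=
  \big[@ser_mul C letter/@ser_one C letter]_(i < 5)
     (fun W => signed_zeta zsh (rho_word (tnth rhos i) W)).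

Lemma pentagon_coef_nil : zsh [::] = 1 -> pentagon_coef [::] = 1.
Proof.
move=> z1; rewrite /pentagon_coef.
rewrite (big_morph (fun f => f [::]) (id1 := 1) (op1 := *%R)).
- by rewrite big1// => i _; rewrite /signed_zeta /= mul1r z1.
- by move=> f g; rewrite /ser_mul big_ord1.
- by [].
Qed.

Lemma pentagon_emb : pentagon zsh <-> eqUB5 (emb pentagon_coef) (@ser_one C _).
Proof.
have h2 : 2^-1 * 2 = 1 :> C by rewrite mulVf// pnatr_eq0.
have eqX r x a i j : letter_idx a = (i, j) ->
    (forall b, (r b == Some x) = (b == a)) ->
    eqUB5 (Xgen C i j) (emb (letters_over C r x)).
  by move=> e h; rewrite (emb_letters_over1 _ h) e; exact: eqUB5_refl.
have P1 := eqUB5_subst (Phi_KZ zsh) (erefl 0) (erefl 0)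
  (eqX rho1 false X12 1 2 erefl ltac:(by case; rewrite letter_eqE))
  (eqX rho1 true X23 2 3 erefl ltac:(by case; rewrite letter_eqE)).
have P2 := eqUB5_subst (Phi_KZ zsh) (erefl 0) (erefl 0)
  (eqX rho2 false X34 3 4 erefl ltac:(by case; rewrite letter_eqE))
  (eqX rho2 true X45 4 5 erefl ltac:(by case; rewrite letter_eqE)).
have P3 := eqUB5_subst (Phi_KZ zsh) (erefl 0) (erefl 0)
  (eqUB5_X51 (r := rho3) (x := false) h2
    ltac:(by case; rewrite !inE !letter_eqE))
  (eqX rho3 true X12 1 2 erefl ltac:(by case; rewrite letter_eqE)).
have P4 := eqUB5_subst (Phi_KZ zsh) (erefl 0) (erefl 0)
  (eqX rho4 false X23 2 3 erefl ltac:(by case; rewrite letter_eqE))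
  (eqX rho4 true X34 3 4 erefl ltac:(by case; rewrite letter_eqE)).
have P5 := eqUB5_subst (Phi_KZ zsh) (erefl 0) (erefl 0)
  (eqX rho5 false X45 4 5 erefl ltac:(by case; rewrite letter_eqE))
  (eqUB5_X51 (r := rho5) (x := true) h2
    ltac:(by case; rewrite !inE !letter_eqE)).
have := ser_mul_congr P1 (ser_mul_congr P2
  (ser_mul_congr P3 (ser_mul_congr P4 P5))).
rewrite -!emb_mul (_ : ser_mul _ _ = pentagon_coef); last first.
  rewrite /pentagon_coef !big_ord_recl big_ord0 ser_mulr1.
  by rewrite !(tnth_nth rho1).
rewrite /pentagon => hP; split=> h.
  exact: eqUB5_trans (eqUB5_sym hP) h.
exact: eqUB5_trans hP h.
Qed.

End PentagonCoordinates.

Theorem theorem3p16 (R : realType) (zsh : seq bool -> R) (Ireg : seq bool -> R)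
    (l : word -> word -> R[i])
    (hzsh : is_zeta_sh zsh) (hIreg : is_reg_integral Ireg)
    (hl : is_B4_coord l) :
  (pentagon zsh <->
     (forall b : word, B4 b -> b <> [::] ->
        gamma_integral Ireg (dual_B4 l b) = 0)) /\
  (forall b : word, B4 b -> b <> [::] ->
     relation_lhs zsh l b = gamma_integral Ireg (dual_B4 l b)).
Proof.
have E b : relation_lhs zsh l b = gamma_integral Ireg (dual_B4 l b).
  exact: relation_lhs_gamma_integral.
have E' b : gamma_integral Ireg (dual_B4 l b) =
    \sum_(W \in [set: word]) l b W * pentagon_coef zsh W.
  rewrite -E; apply: eq_fsbigr => W _; congr (_ * _).
  exact: (fsbig_flatten (fun i W =>
    signed_zeta zsh (rho_word (tnth rhos i) W))).
split=> [|b _ _]; last exact: E.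
have c1 := pentagon_coef_nil (zeta_sh_nil hzsh).
split=> [/pentagon_emb/(eqUB5_one_coord hl c1) h b Bb b0|h].
  by rewrite E' h.
by apply/pentagon_emb/(eqUB5_one_coord hl c1) => b Bb b0; rewrite -E' h.
Qed.
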